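(* Let $N \ge 3$ be an integer, let $P_N$ be the set of all $N$-gons in $\mathbb{R}^2$, let $\Omega_0$ be the regular $N$-gon of unit area, and let $0 < p < 2$. (i) There is no constant $C_1$ such that for every $\Omega \in P_N$ with $|\Omega| = 1$ there exists a rigid motion $\rho$ of $\mathbb{R}^2$ with $$|\Omega \,\Delta\, \rho\Omega_0|^p \le C_1\,\bigl(h(\Omega) - h(\Omega_0)\bigr).$$ (ii) It is not true that for every $M > 0$ there exists a constant $C_2$ such that for every $\Omega \in P_N$ with $\operatorname{diam}(\Omega) < M$ and $|\Omega| = 1$ there exists a rigid motion $\rho$ of $\mathbb{R}^2$ with $$\operatorname{hd}(\partial \Omega, \partial \rho\Omega_0)^p \le C_2\,\bigl(h(\Omega) - h(\Omega_0)\bigr).$$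
   Context: For a Borel set $\Omega \subset \mathbb{R}^2$ of finite positive measure, the Cheeger constant of $\Omega$ is $$h(\Omega) = \inf\left\{ \frac{P(E)}{|E|} \;:\; E \subseteq \Omega \text{ measurable},\ |E| > 0 \right\},$$ where $|\cdot|$ denotes Lebesgue measure (area) and $P(E)$ is the perimeter of $E$ (in the sense of sets of finite perimeter, with $P(E)=+\infty$ if $E$ does not have finite perimeter). An $N$-gon is a (not necessarily convex) polygon with $N$ sides, that is, the planar region bounded by a simple closed polygonal curve with $N$ sides. $\operatorname{hd}(\cdot,\cdot)$ denotes the Hausdorff distance between sets, $\Delta$ the symmetric difference, $\operatorname{diam}$ the diameter, and $\rho\Omega_0 = \rho(\Omega_0)$. *)

(* Defs.v *)
(* Points of the plane are pairs in R * R, R : realType (MathComp-Analysis).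
   The library norm on R * R is the sup norm, so metric quantities go through
   norm2; topological notions (closure, compactness, boundedness, connected
   components, differentiability) do not depend on the choice of norm. *)
From HB Require Import structures.
From mathcomp Require Import all_boot all_order all_algebra.
From mathcomp Require Import all_classical all_reals all_analysis.
Set Implicit Arguments.
Unset Strict Implicit.
Unset Printing Implicit Defensive.
Import Order.TTheory GRing.Theory Num.Theory numFieldNormedType.Exports.
Local Open Scope classical_set_scope.
Local Open Scope ring_scope.

Definition norm2 (R : realType) (x : R * R) : R :=
  Num.sqrt (x.1 ^+ 2 + x.2 ^+ 2).

Definition dist2 (R : realType) (x y : R * R) : R := norm2 (x - y).

(* Orientation-reversing isometries are included. *)
Definition rigid_motion (R : realType) (rho : R * R -> R * R) : Prop :=
  forall x y, dist2 (rho x) (rho y) = dist2 x y.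

Definition boundary (R : realType) (A : set (R * R)) : set (R * R) :=
  closure A `\` A°.

Definition diam (R : realType) (A : set (R * R)) : \bar R :=
  ereal_sup [set (dist2 x y)%:E | x in A & y in A].

Definition dist_to (R : realType) (B : set (R * R)) (x : R * R) : \bar R :=
  ereal_inf [set (dist2 x y)%:E | y in B].

Definition hausdorff_dist (R : realType) (A B : set (R * R)) : \bar R :=
  maxe (ereal_sup [set dist_to B x | x in A])
       (ereal_sup [set dist_to A y | y in B]).

Definition area (R : realType) : set (R * R) -> \bar R :=
  (@lebesgue_measure R \x @lebesgue_measure R)%E.

(* Continuously differentiable, compactly supported plane vector fields of
   Euclidean length at most 1. *)
Definition test_field (R : realType) (phi : R * R -> R * R) : Prop :=
  [/\ forall x, differentiable phi x,
      continuous (fun x => 'D_((1, 0) : R * R) phi x),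
      continuous (fun x => 'D_((0, 1) : R * R) phi x),
      compact (closure [set x | phi x != 0]) &
      forall x, norm2 (phi x) <= 1].

Definition divergence (R : realType) (phi : R * R -> R * R) (x : R * R) : R :=
  ('D_((1, 0) : R * R) phi x).1 + ('D_((0, 1) : R * R) phi x).2.

(* De Giorgi perimeter: the total variation of the indicator function of E,
   equal to +oo when E does not have finite perimeter. *)
Definition perimeter (R : realType) (E : set (R * R)) : \bar R :=
  ereal_sup [set (\int[(@lebesgue_measure R \x @lebesgue_measure R)%E]_(x in E)
                    (divergence phi x)%:E)%E | phi in @test_field R].

Definition cheeger (R : realType) (Omega : set (R * R)) : \bar R :=
  ereal_inf [set (perimeter E / area E)%E | E in
    [set E : set (R * R) | [/\ E `<=` Omega, measurable E & (0 < area E)%E]]].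

Definition segment (R : realType) (a b : R * R) : set (R * R) :=
  [set (1 - t) *: a + t *: b | t in `[0, 1]].

(* Vertices are listed in cyclic order; ordS is the cyclic successor on 'I_N. *)
Definition edge (R : realType) (N : nat) (v : 'I_N -> R * R) (i : 'I_N) :
    set (R * R) :=
  segment (v i) (v (ordS i)).

Definition polygonal_curve (R : realType) (N : nat) (v : 'I_N -> R * R) :
    set (R * R) :=
  \bigcup_(i in [set: 'I_N]) edge v i.

(* Distinct edges can only meet at the common vertex of consecutive edges. *)
Definition simple_curve (R : realType) (N : nat) (v : 'I_N -> R * R) : Prop :=
  forall (i j : 'I_N) (x : R * R), i != j -> edge v i x -> edge v j x ->
    (j = ordS i /\ x = v j) \/ (i = ordS j /\ x = v i).

Definition cross (R : realType) (a b : R * R) : R := a.1 * b.2 - a.2 * b.1.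

(* Consecutive edges are nondegenerate and not collinear, so that each of the
   N edges is a genuine side. *)
Definition genuine_sides (R : realType) (N : nat) (v : 'I_N -> R * R) : Prop :=
  forall i : 'I_N,
    cross (v (ordS i) - v i) (v (ordS (ordS i)) - v (ordS i)) != 0.

(* The points off the curve lying in a bounded component of its complement
   (the open Jordan interior). *)
Definition polygon_region (R : realType) (N : nat) (v : 'I_N -> R * R) :
    set (R * R) :=
  [set x | ~ polygonal_curve v x /\
           bounded_set (connected_component (~` polygonal_curve v) x)].

Definition is_ngon (R : realType) (N : nat) (Omega : set (R * R)) : Prop :=
  exists v : 'I_N -> R * R,
    [/\ simple_curve v, genuine_sides v & Omega = polygon_region v].

Definition regular_vertices (R : realType) (N : nat) (c : R * R) (r theta : R)
    (k : 'I_N) : R * R :=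
  let t := theta + 2 * pi * k%:R / N%:R in (c.1 + r * cos t, c.2 + r * sin t).

Definition is_regular_ngon (R : realType) (N : nat) (Omega : set (R * R)) :
    Prop :=
  exists (c : R * R) (r theta : R),
    0 < r /\ Omega = polygon_region (regular_vertices (N := N) c r theta).

(* Main.v *)
(* Let T_a stretch the plane by a in a direction e and by 1/a in the orthogonal
   direction.  Omega_a := T_a(Omega0) is an N-gon of unit area whose distance to
   every isometric copy of Omega0 is at least of order a - 1.  Its Cheeger
   constant, however, exceeds h(Omega0) only by O((a - 1)^2): if g is the
   rotation of order N preserving Omega0 and E is a competitor for Omega0, then
   so are the sets g^k(E), and averaging over k cancels the first order term of
   the perimeter of T_a(g^k(E)).  On the level of test fields this says that
   fields phi_k for T_a(g^k(E)) add up to the field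
   sum_k (T_a g^k)^-1 o phi_k o (T_a g^k) for E, of length at most
   N ((a + 1/a)/2)^2 since sum_k |T_a^-1 g^k z|^2 = N (a^2 + a^-2) |z|^2 / 2.

   For the area, one compares second moments in the direction e: Omega0 has an
   isotropic inertia tensor, so that its copies all have the same directional
   moment about their center, while that of Omega_a is larger by a factor a^2
   about any point.  For the Hausdorff distance, e is chosen along a diameter of
   the boundary, which T_a lengthens by the factor a.  Negative constants are
   excluded by h(Omega_a) -> +oo as a -> +oo. *)
Require Import Defs.
From HB Require Import structures.
From mathcomp Require Import all_boot all_order all_algebra.
From mathcomp Require Import all_classical all_reals all_analysis.
From mathcomp Require Import measurable_realfun ring lra zify.
Set Implicit Arguments.
Unset Strict Implicit.
Unset Printing Implicit Defensive.
Import Order.TTheory GRing.Theory Num.Theory numFieldNormedType.Exports.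
Local Open Scope classical_set_scope.
Local Open Scope ring_scope.

(* [R * R] and [plane R] carry the same measurable sets, but only the latter has
   the display that the product of Lebesgue measures expects. *)
Notation plane R := (measurableTypeR R * measurableTypeR R)%type.
Local Notation lebesgue2 R := (@lebesgue_measure R \x @lebesgue_measure R)%E.

(** * Area and affine maps *)

(** With [a = 1 + eps], both inequalities would force a quantity of order [eps^p] below a deficit of
    order [eps^2]. The delicate point is to remove the first order term from [h(Omega_a)] when
    nothing is known about the shape of good competitors. This is why the averaging acts on test
    fields and by contraposition: no optimal [E] is chosen, and for each competitor [E] some [k],
    depending on [E], makes [T_a(g^k(E))] good enough. A linear pullback leaves the divergence of a
    field unchanged and alters only its length, which the sum over [k] controls.

    The lower bounds on the distances must hold for all rigid motions at once. For the area, the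
    moment of [Omega_a] is taken about the center of the copy: by the parallel axis theorem a
    displacement of the copy can only increase it. An upper bound for the weight is available as
    soon as the two sets meet, and disjoint sets are as far apart in area as possible.

    Cheeger constants are extended reals, so their difference is turned into a real number only
    after both are shown finite, by means of a box inside the polygon. *)

Lemma open_measurable2 (R : realType) (U : set (R * R)) : open U ->
  measurable (U : set (plane R)).
Proof.
move=> oU.
pose box (q : (rat * rat) * (rat * rat)) : set (R * R) :=
  `]ratr q.1.1, ratr q.1.2[%classic `*` `]ratr q.2.1, ratr q.2.2[%classic.
have -> : U = \bigcup_(q in [set q | box q `<=` U]) box q.
  apply/seteqP; split=> [x Ux|x [q qU bx]]; last exact: qU.
  have /nbhs_ballP[e /= e0 eU] : nbhs x U by move: oU; rewrite openE; apply.
  have rat_near (t : R) : exists q : rat * rat,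
      (t \in `]ratr q.1, ratr q.2[) /\
      forall s, s \in `]ratr q.1 : R, ratr q.2[ -> ball t e s.
    have [q1 q1t] : exists q : rat, ratr q \in `](t - e), t[.
      by apply: rat_in_itvoo; rewrite ltrBlDr ltrDl.
    have [q2 q2t] : exists q : rat, ratr q \in `]t, (t + e)[.
      by apply: rat_in_itvoo; rewrite ltrDl.
    exists (q1, q2); move: q1t q2t; rewrite !in_itv/= => /andP[a b] /andP[c d].
    split; first by rewrite b c.
    move=> s; rewrite in_itv/= => /andP[sa sb].
    by rewrite /ball/= ltr_norml; apply/andP; split; lra.
  have [q [qx qe]] := rat_near x.1; have [r [rx re]] := rat_near x.2.
  exists (q, r) => //= y [y1 y2]; apply: eU; split => /=; [exact: qe|exact: re].
rewrite bigcup_mkcond; apply: countable_bigcupT_measurable => // q.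
by case: ifPn => // _; apply: measurableX.
Qed.

Lemma continuous_measurable_fun2 (R : realType) (f : R * R -> R) :
  continuous f -> measurable_fun (setT : set (plane R)) f.
Proof.
move=> /continuousP cf; apply: (measurability _ (RGenOpens.measurableE R)).
move=> _ [_ [a [b ->] <-]]; rewrite setTI; apply: open_measurable2.
by apply: cf; exact: interval_open.
Qed.

(** Preimages make this an equality between a pushforward measure and the area, which composes and
    needs no injectivity. *)
Definition preserves_area (R : realType) (f : R * R -> R * R) : Prop :=
  measurable_fun setT (f : plane R -> plane R) /\
  forall A : set (plane R), measurable A -> area (f @^-1` A) = area A.

Lemma preserves_area_comp (R : realType) (f g : R * R -> R * R) :
  preserves_area f -> preserves_area g -> preserves_area (f \o g).
Proof.
move=> [mf pf] [mg pg]; split; first exact: measurableT_comp.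
move=> A mA; rewrite comp_preimage pg ?pf//.
by rewrite -[X in measurable X]setTI; exact: mf.
Qed.

(** The pushforward under a translation agrees with Lebesgue measure on half-open intervals, and
    these determine the measure. *)
Lemma lebesgue_measure_addr (R : realType) (t : R) (A : set R) : measurable A ->
  lebesgue_measure [set y | A (y + t)] = lebesgue_measure A.
Proof.
move=> mA.
have mt : measurable_fun setT ((fun y => y + t) : R -> measurableTypeR R).
  exact: measurable_funD.
rewrite -[LHS]/(pushforward (@lebesgue_measure R)
  ((fun y => y + t) : R -> measurableTypeR R) A).
apply/esym/lebesgue_measure_unique => //= _ [[a b]] _ <-.
rewrite /pushforward.
have -> : ((fun y : R => y + t) @^-1` `]a, b] = `]a - t, b - t])%classic.
  by apply/seteqP; split=> y /=; rewrite !in_itv/= ltrBlDr lerBrDr.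
rewrite !lebesgue_measure_itv/= !lte_fin ltrD2r.
by case: ifP => // _; rewrite -!EFinD; congr EFin; ring.
Qed.

(** The area integrates the lengths of vertical sections, and the shear translates each section by a
    constant. *)
Lemma shear_preserves_area (R : realType) (s : R -> R) :
  measurable_fun setT s ->
  preserves_area (fun x => (x.1, x.2 + s x.1)).
Proof.
move=> ms; have mf : measurable_fun setT
    ((fun x => (x.1, x.2 + s x.1)) : plane R -> plane R).
  apply: measurable_fun_pair => //=.
  by apply: measurable_funD => //; exact: measurableT_comp.
split=> // A mA; rewrite /area /product_measure1; apply: eq_integral => x _ /=.
rewrite -(@lebesgue_measure_addr _ (s x) (xsection A x)); last first.
  exact: measurable_xsection.
by congr (lebesgue_measure _); apply/seteqP; split=> y /=.
Qed.

Lemma swap_preserves_area (R : realType) :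
  preserves_area (fun x : R * R => (x.2, x.1)).
Proof.
have mf : measurable_fun setT ((fun x => (x.2, x.1)) : plane R -> plane R).
  exact: measurable_fun_pair.
split=> // A mA.
pose m : {measure set (plane R) -> \bar R} :=
  pushforward (lebesgue2 R)
    ((fun x => (x.2, x.1)) : plane R -> plane R).
apply/esym/(@product_measure_unique _ _ _ _ R (@lebesgue_measure R)
  (@lebesgue_measure R) (m mf)) => // B C mB mC /=.
rewrite /pushforward.
have -> : (fun x : R * R => (x.2, x.1)) @^-1` (B `*` C) = C `*` B.
  by apply/seteqP; split=> x /= [].
by rewrite /area product_measure1E// muleC.
Qed.

(* [p] and [q] are the columns of the linear part, [cross p q] its determinant. *)
Definition affine_map (R : realType) (p q t x : R * R) : R * R :=
  (x.1 * p.1 + x.2 * q.1 + t.1, x.1 * p.2 + x.2 * q.2 + t.2).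

Lemma cross_affine_map (R : realType) (p q p' q' : R * R) :
  cross (affine_map p q 0 p') (affine_map p q 0 q') = cross p q * cross p' q'.
Proof. by rewrite /cross /affine_map /=; ring. Qed.

Lemma lower_shear_preserves_area (R : realType) (c : R) (t : R) :
  preserves_area (affine_map (1, c) (0, 1) (0, t)).
Proof.
have -> : affine_map (1, c) (0, 1) (0, t) =
  (fun x => (x.1, x.2 + (x.1 * c + t))).
  by apply/funext => x; rewrite /affine_map/=; congr pair; ring.
apply: (shear_preserves_area (s := fun a => a * c + t)).
by apply: measurable_funD => //; exact: measurable_funM.
Qed.

Lemma upper_shear_preserves_area (R : realType) (c : R) (t : R) :
  preserves_area (affine_map (1, 0) (c, 1) (t, 0)).
Proof.
have -> : affine_map (1, 0) (c, 1) (t, 0) = (fun x => (x.2, x.1)) \o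
    (affine_map (1, c) (0, 1) (0, t) \o (fun x => (x.2, x.1))).
  by apply/funext => x; rewrite /affine_map/=; congr pair; ring.
apply: preserves_area_comp; first exact: swap_preserves_area.
apply: preserves_area_comp; last exact: swap_preserves_area.
exact: lower_shear_preserves_area.
Qed.

(** A matrix of determinant 1 with nonzero lower left entry is a product of an upper, a lower and an
    upper shear. If that entry vanishes, adding the first row to the second makes it nonzero.
    Determinant -1 is reduced to 1 by exchanging the columns, and translations are shears with
    trivial linear part. *)
Lemma affine_preserves_area (R : realType) (p q t : R * R) :
  `|cross p q| = 1 -> preserves_area (affine_map p q t).
Proof.
have det1c (p' q' : R * R) : p'.2 != 0 -> cross p' q' = 1 ->
    preserves_area (affine_map p' q' 0).
  case: p' => a c; case: q' => b d; rewrite /cross/= => c0 det1.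
  have -> : affine_map (a, c) (b, d) 0 =
    affine_map (1, 0) ((a - 1) / c, 1) (0, 0) \o
      (affine_map (1, c) (0, 1) (0, 0) \o affine_map (1, 0) ((d - 1) / c, 1)
        (0, 0)).
    have bE : b = (a * d - 1) / c by rewrite -det1; field.
    by apply/funext => x; rewrite /affine_map/= bE; congr pair; field.
  apply: preserves_area_comp; first exact: upper_shear_preserves_area.
  apply: preserves_area_comp; last exact: upper_shear_preserves_area.
  exact: lower_shear_preserves_area.
have det1 (p' q' : R * R) : cross p' q' = 1 ->
  preserves_area (affine_map p' q' 0).
  have [c0|] := eqVneq p'.2 0; last exact: det1c.
  move: p' q' c0 => [a c] [b d]; rewrite /cross/= => -> det1.
  have a0 : a != 0 by apply: contra_eq_neq det1 => ->;
    rewrite !mul0r subr0 eq_sym oner_neq0.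
  have -> : affine_map (a, 0) (b, d) 0 = affine_map (1, -1) (0, 1) (0, 0) \o
      affine_map (a, a) (b, d + b) 0.
    by apply/funext => x; rewrite /affine_map/=; congr pair; ring.
  apply: preserves_area_comp; first exact: lower_shear_preserves_area.
  by apply: det1c => //=; rewrite /cross/= -det1; ring.
move=> H.
have -> : affine_map p q t = affine_map (1, 0) (0, 1) (t.1, 0) \o
   (affine_map (1, 0) (0, 1) (0, t.2) \o affine_map p q 0).
  by apply/funext => x; rewrite /affine_map/=; congr pair; ring.
apply: preserves_area_comp; first exact: upper_shear_preserves_area.
apply: preserves_area_comp; first exact: lower_shear_preserves_area.
have [?|h] : cross p q = 1 \/ cross p q = -1.
  by move/eqP: H; rewrite eqr_norml => /andP[/orP[]/eqP] ->; [left|right].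
  exact: det1.
have -> : affine_map p q 0 = affine_map q p 0 \o (fun x => (x.2, x.1)).
  by apply/funext => x; rewrite /affine_map/=; congr pair; ring.
apply: preserves_area_comp; last exact: swap_preserves_area.
by apply: det1; rewrite -[RHS]opprK -h /cross; ring.
Qed.

Lemma affine_map_inv (R : realType) (p q t : R * R) : cross p q != 0 ->
  exists p' q' t' : R * R, [/\ cross p' q' = (cross p q)^-1,
   cancel (affine_map p q t) (affine_map p' q' t') &
   cancel (affine_map p' q' t') (affine_map p q t)].
Proof.
move=> d0; pose d := cross p q.
pose p' := (q.2 / d, - p.2 / d); pose q' := (- q.1 / d, p.1 / d).
exists p', q', (- affine_map p' q' 0 t).
split.
- by rewrite /cross/=; move: d0; rewrite /d /cross => d0; field.
- move=> [x1 x2]; rewrite /affine_map/=; move: d0; rewrite /d /cross => d0.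
  by congr pair; field.
- move=> [x1 x2]; rewrite /affine_map/=; move: d0; rewrite /d /cross => d0.
  by congr pair; field.
Qed.

Lemma preimage_can (T U : Type) (f : T -> U) (g : U -> T) (A : set U) :
  cancel f g -> cancel g f -> f @^-1` A = g @` A.
Proof.
move=> fg gf; apply/seteqP; split=> [x fx|_ [y Ay <-]] /=; last by rewrite gf.
by exists (f x).
Qed.

Lemma image_affine_measurable (R : realType) (p q t : R * R)
  (A : set (plane R)) :
  `|cross p q| = 1 -> measurable A -> measurable
    (affine_map p q t @` A : set (plane R)).
Proof.
move=> d1 mA; have d0 : cross p q != 0 by rewrite -normr_gt0 d1.
have [p' [q' [t' [dE fg gf]]]] := affine_map_inv t d0.
rewrite -(preimage_can A gf fg) -[X in measurable X]setTI.
have [mf _] : preserves_area (affine_map p' q' t').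
  by apply: affine_preserves_area; rewrite dE normfV d1 invr1.
exact: mf.
Qed.

Lemma area_affine (R : realType) (p q t : R * R) (A : set (plane R)) :
  `|cross p q| = 1 -> measurable A -> area (affine_map p q t @` A) = area A.
Proof.
move=> d1 mA; have d0 : cross p q != 0 by rewrite -normr_gt0 d1.
have [p' [q' [t' [dE fg gf]]]] := affine_map_inv t d0.
rewrite -(preimage_can A gf fg).
have [_ ->] // : preserves_area (affine_map p' q' t').
by apply: affine_preserves_area; rewrite dE normfV d1 invr1.
Qed.

Lemma ge0_integral_affine (R : realType) (p q t : R * R) (A : set (plane R))
    (f : R * R -> R) : `|cross p q| = 1 -> measurable A ->
  measurable_fun (setT : set (plane R)) f -> (forall x, 0 <= f x) ->
  (\int[lebesgue2 R]_(x in affine_map p q t @` A) (f x)%:E =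
  \int[lebesgue2 R]_(x in A) (f (affine_map p q t x))%:E)%E.
Proof.
move=> d1 mA mf f0; have [ma pa] := affine_preserves_area t d1.
have mfA := image_affine_measurable t d1 mA.
transitivity (\int[pushforward (lebesgue2 R)
  (affine_map p q t : plane R -> plane R)]_(x in affine_map p q t @` A)
  (f x)%:E)%E.
  by apply: eq_measure_integral => B mB _; rewrite /pushforward; exact/esym/pa.
rewrite ge0_integral_pushforward//=; last 2 first.
- by apply: measurable_funTS; exact: measurableT_comp.
- by move=> x _; rewrite lee_fin.
congr integral; apply/seteqP; split=> [x [y Ay yx]|x Ax]; last by exists x.
have d0 : cross p q != 0 by rewrite -normr_gt0 d1.
have [p' [q' [t' [dE fg gf]]]] := affine_map_inv t d0.
by rewrite (can_inj fg (esym yx)).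
Qed.

(** Divergences have no sign, hence this version beside the nonnegative one, which serves the second
    moments. *)
Lemma integral_affine (R : realType) (p q t : R * R) (A : set (plane R))
    (f : R * R -> R) : `|cross p q| = 1 -> measurable A ->
  measurable_fun (setT : set (plane R)) f ->
  (lebesgue2 R).-integrable A (fun x => (f (affine_map p q t x))%:E) ->
  (\int[lebesgue2 R]_(x in affine_map p q t @` A) (f x)%:E =
  \int[lebesgue2 R]_(x in A) (f (affine_map p q t x))%:E)%E.
Proof.
move=> d1 mA mf f0; have [ma pa] := affine_preserves_area t d1.
have mfA := image_affine_measurable t d1 mA.
have prA : affine_map p q t @^-1` (affine_map p q t @` A) = A.
  apply/seteqP; split=> [x [y Ay yx]|x Ax]; last by exists x.
  have d0 : cross p q != 0 by rewrite -normr_gt0 d1.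
  have [p' [q' [t' [dE fg gf]]]] := affine_map_inv t d0.
  by rewrite (can_inj fg (esym yx)).
transitivity (\int[pushforward (lebesgue2 R)
  (affine_map p q t : plane R -> plane R)]_(x in affine_map p q t @` A)
  (f x)%:E)%E.
  by apply: eq_measure_integral => B mB _; rewrite /pushforward; exact/esym/pa.
have mf' : measurable_fun (setT : set (plane R)) (EFin \o f).
  exact: measurableT_comp.
rewrite (@integral_pushforward _ _ _ _ R _ ma _ _ (EFin \o f) mf')//.
  by rewrite prA.
by rewrite prA.
Qed.

(** * Test fields and affine changes of variables *)

Lemma is_diff_fst (R : realType) (x : R * R) : is_diff x (fst : R * R -> R) fst.
Proof.
pose l : {linear (R * R)%type -> R^o} := fst.
have cl : continuous (l : R * R -> R) by move=> ?; exact: cvg_fst.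
by apply: DiffDef; [exact: (@linear_differentiable _ _ _ l)
                   |exact: (@diff_lin _ _ _ l)].
Qed.

Lemma is_diff_snd (R : realType) (x : R * R) : is_diff x (snd : R * R -> R) snd.
Proof.
pose l : {linear (R * R)%type -> R^o} := snd.
have cl : continuous (l : R * R -> R) by move=> ?; exact: cvg_snd.
by apply: DiffDef; [exact: (@linear_differentiable _ _ _ l)
                   |exact: (@diff_lin _ _ _ l)].
Qed.

Lemma is_diff_affine (R : realType) (p q t x : R * R) :
  is_diff x (affine_map p q t) (affine_map p q 0).
Proof.
have h (a b c : R) : is_diff x (fun y : R * R => y.1 * a + y.2 * b + c)
    (fun y => y.1 * a + y.2 * b + 0).
  have -> : (fun y : R * R => y.1 * a + y.2 * b + c) =
     (a *: fst + b *: snd + cst c : R * R -> R).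
    by apply/funext => y; rewrite /= !fctE /GRing.scale/= mulrC (mulrC b).
  have d1 := is_diff_fst x; have d2 := is_diff_snd x.
  apply: (is_diff_eq (is_diffD (is_diffD (is_diffZ a d1) (is_diffZ b d2))
    (is_diff_cst c x))); apply/funext => y.
  by rewrite /= !fctE /GRing.scale/= mulrC (mulrC b).
by apply: is_diff_pair; exact: h.
Qed.

Lemma continuous_affine (R : realType) (p q t : R * R) :
  continuous (affine_map p q t).
Proof.
by move=> x; apply: differentiable_continuous; case: (is_diff_affine p q t x).
Qed.

Lemma derive_coord (R : realType) (phi : R * R -> R * R) (x v : R * R) :
  differentiable phi x ->
  'D_v phi x =
  v.1 *: 'D_((1, 0) : R * R) phi x + v.2 *: 'D_((0, 1) : R * R) phi x.
Proof.
move=> dphi; rewrite !(deriveE _ dphi).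
rewrite -[X in X + _]linearZ -[X in _ + X]linearZ -linearD.
congr ('d phi x _); case: v => a b.
by rewrite -[RHS]/(a * 1 + b * 0, a * 0 + b * 1); congr pair; ring.
Qed.

Lemma derive_pullback (R : realType) (phi : R * R -> R * R)
  (p q t p' q' x v : R * R) :
  differentiable phi (affine_map p q t x) ->
  differentiable (affine_map p' q' 0 \o phi \o affine_map p q t) x /\
  'D_v (affine_map p' q' 0 \o phi \o affine_map p q t) x =
   affine_map p' q' 0 ('D_(affine_map p q 0 v) phi (affine_map p q t x)).
Proof.
move=> dphi; have da := is_diff_affine p q t x.
have db := is_diff_affine p' q' 0 (phi (affine_map p q t x)).
have [da1 da2] := da.
have dp : is_diff (affine_map p q t x) phi ('d phi (affine_map p q t x)).
  exact: DiffDef.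
have [d1 d2] : is_diff x (affine_map p' q' 0 \o phi \o affine_map p q t)
   (affine_map p' q' 0 \o 'd phi (affine_map p q t x) \o affine_map p q 0).
  exact: is_diff_comp.
by split; [exact: d1|rewrite (deriveE _ d1) d2 (deriveE _ dphi)].
Qed.

(** Without the length bound of [test_field] the class is closed under finite sums and invertible
    affine pullbacks; lengths are tracked separately. *)
Definition C1c_field (R : realType) (phi : R * R -> R * R) : Prop :=
  [/\ forall x, differentiable phi x,
      continuous (fun x => 'D_((1, 0) : R * R) phi x),
      continuous (fun x => 'D_((0, 1) : R * R) phi x) &
      compact (closure [set x | phi x != 0])].

Lemma test_fieldE (R : realType) (phi : R * R -> R * R) :
  test_field phi <-> C1c_field phi /\ forall x, norm2 (phi x) <= 1.
Proof. by split=> [[? ? ? ? ?]|[[? ? ? ?] ?]]; [split; [split|]|split]. Qed.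

Lemma compact_support (R : realType) (phi : R * R -> R * R) (K : set (R * R)) :
  compact K -> (forall x, phi x != 0 -> K x) ->
  compact (closure [set x | phi x != 0]).
Proof.
move=> cK phiK; apply: (subclosed_compact (@closed_closure _ _) cK).
have /closure_id -> : closed K.
  exact: compact_closed.
by apply: closure_subset => x; exact: phiK.
Qed.

Lemma C1c_field_pullback (R : realType) (phi : R * R -> R * R)
  (p q t p' q' : R * R) :
  cross p q != 0 -> C1c_field phi ->
  C1c_field (affine_map p' q' 0 \o phi \o affine_map p q t).
Proof.
move=> d0 [dphi c1 c2 cK].
have cD v : continuous (fun x => 'D_v (affine_map p' q' 0 \o phi \o affine_map p
  q t) x).
  have -> : (fun x => 'D_v (affine_map p' q' 0 \o phi \o affine_map p q t) x) =
    affine_map p' q' 0 \o (fun y => (affine_map p q 0 v).1 *: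
      'D_((1, 0) : R * R) phi y
     + (affine_map p q 0 v).2 *: 'D_((0, 1) : R * R) phi y) \o affine_map p q t.
    by apply/funext => x; have [_ ->] :=
      derive_pullback p' q' v (dphi (affine_map p q t x));
      rewrite /= derive_coord.
  move=> x; apply: continuous_comp; first exact: continuous_affine.
  apply: continuous_comp; last exact: continuous_affine.
  apply: cvgD; apply: cvgZr; [exact: c1|exact: c2].
split; [|exact: cD|exact: cD|].
- by move=> x; exact: (derive_pullback p' q' 0 (dphi (affine_map p q t x))).1.
- have [r [s [u [_ fg gf]]]] := affine_map_inv t d0.
  apply: (compact_support (K := affine_map r s u @` closure
    [set x | phi x != 0])).
    by apply: continuous_compact => //; apply: continuous_subspaceT;
      exact: continuous_affine.
  move=> x /= h; exists (affine_map p q t x) => //; apply: subset_closure => /=.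
  by apply: contra_neq h => ->; rewrite /affine_map/= !mul0r !addr0.
Qed.

(** If [A] has columns [p], [q] and [A^-1] has columns [p'], [q'], the Jacobian of the pulled back
    field is [A^-1 (D phi) A], which has the same trace as [D phi]. *)
Lemma divergence_pullback (R : realType) (phi : R * R -> R * R)
  (p q t p' q' x : R * R) :
  affine_map p q 0 p' = (1, 0) -> affine_map p q 0 q' = (0, 1) ->
  (forall x, differentiable phi x) ->
  divergence (affine_map p' q' 0 \o phi \o affine_map p q t) x =
  divergence phi (affine_map p q t x).
Proof.
move=> [e1 e2] [e3 e4] dphi; rewrite /divergence.
have [_ ->] := derive_pullback p' q' (1, 0) (dphi (affine_map p q t x)).
have [_ ->] := derive_pullback p' q' (0, 1) (dphi (affine_map p q t x)).
rewrite ![in 'D_(affine_map _ _ _ _) _ _]/affine_map /=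
  !mul0r !mul1r !addr0 !add0r.
rewrite derive_coord// [in X in _ + X]derive_coord//=.
case: ('D_(1, 0) phi _) => a1 a2; case: ('D_(0, 1) phi _) => b1 b2 /=.
rewrite /affine_map /=.
rewrite /GRing.scale/=.
move: e1 e2 e3 e4; rewrite !addr0 => e1 e2 e3 e4.
transitivity (a1 * (p'.1 * p.1 + p'.2 * q.1) + b1 * (p'.1 * p.2 + p'.2 * q.2)
 + a2 * (q'.1 * p.1 + q'.2 * q.1) + b2 * (q'.1 * p.2 + q'.2 * q.2)); last first.
  by rewrite e1 e2 e3 e4; ring.
ring.
Qed.

Lemma C1c_field0 (R : realType) : C1c_field (0 : R * R -> R * R) /\
  forall x, divergence (0 : R * R -> R * R) x = 0.
Proof.
have z v (x : R * R) : 'D_v (0 : R * R -> R * R) x = 0 by exact: derive_cst.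
split; last by move=> x; rewrite /divergence !z addr0.
split.
- by move=> x; exact: differentiable_cst.
- by under eq_fun do rewrite z; move=> x; exact: cvg_cst.
- by under eq_fun do rewrite z; move=> x; exact: cvg_cst.
- by apply: (compact_support compact0) => x; rewrite eqxx.
Qed.

Lemma C1c_field_sum (R : realType) (I : Type) (s : seq I)
  (phi : I -> R * R -> R * R) :
  (forall i, C1c_field (phi i)) ->
  C1c_field (\sum_(i <- s) phi i) /\
  forall x, divergence (\sum_(i <- s) phi i) x =
    \sum_(i <- s) divergence (phi i) x.
Proof.
move=> h; elim: s => [|i s [[d1 d2 d3 d4] ih]].
  have [c0 d0] := C1c_field0 R.
  by rewrite big_nil; split=> // x; rewrite big_nil.
have [e1 e2 e3 e4] := h i.
rewrite big_cons; set f := \sum_(j <- s) phi j in d1 d2 d3 d4 ih *.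
have z v (x : R * R) : 'D_v (phi i + f) x = 'D_v (phi i) x + 'D_v f x.
  by apply: deriveD; exact: diff_derivable.
split; last by move=> x; rewrite big_cons -ih /divergence !z; exact: addrACA.
split.
- by move=> x; exact: (differentiableD (e1 x) (d1 x)).
- by under eq_fun do rewrite z; move=> x; apply: cvgD; [exact: e2|exact: d2].
- by under eq_fun do rewrite z; move=> x; apply: cvgD; [exact: e3|exact: d3].
- apply: (compact_support (compactU e4 d4)) => x; rewrite fctE => h0.
  have [p0|p0] := eqVneq (phi i x) 0.
    by right; apply: subset_closure => /=; move: h0; rewrite p0 add0r.
  by left; exact: subset_closure.
Qed.

(** * Perimeter and Cheeger constant under affine maps *)

Lemma norm2_le (R : realType) (x : R * R) (K : R) : 0 <= K ->
  (norm2 x <= K) = (x.1 ^+ 2 + x.2 ^+ 2 <= K ^+ 2).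
Proof.
by move=> K0; rewrite /norm2 -{1}(ger0_norm K0) -sqrtr_sqr ler_sqrt// sqr_ge0.
Qed.

Lemma norm2_ge0 (R : realType) (x : R * R) : 0 <= norm2 x.
Proof. exact: sqrtr_ge0. Qed.

Lemma sqr_norm2 (R : realType) (x : R * R) : norm2 x ^+ 2 = x.1 ^+ 2 + x.2 ^+ 2.
Proof. by rewrite sqr_sqrtr// addr_ge0// sqr_ge0. Qed.

Lemma integrable_continuous2 (R : realType) (f : R * R -> R) (C : set (R * R))
    (E : set (plane R)) :
  continuous f -> compact C -> E `<=` C -> measurable E -> (area E < +oo)%E ->
  (lebesgue2 R).-integrable E (EFin \o f).
Proof.
move=> cf cC EC mE aE; apply: measurable_bounded_integrable => //.
  by apply: measurable_funTS; exact: continuous_measurable_fun2.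
have /compact_bounded [M [Mr HM]] : compact (f @` C).
  by apply: continuous_compact => //; exact: continuous_subspaceT.
exists M; split=> // x Mx y Ey; apply: HM => //=; exists y => //; exact: EC.
Qed.

Lemma continuous_divergence (R : realType) (phi : R * R -> R * R) :
  C1c_field phi -> continuous (divergence phi).
Proof.
move=> [_ c1 c2 _] x.
have f1 (y : R * R) : {for y, continuous (fst : R * R -> R)} by exact: cvg_fst.
have f2 (y : R * R) : {for y, continuous (snd : R * R -> R)} by exact: cvg_snd.
apply: cvgD.
  exact: (continuous_comp (c1 x) (f1 _)).
exact: (continuous_comp (c2 x) (f2 _)).
Qed.

Lemma perimeter_ge0 (R : realType) (E : set (R * R)) : (0 <= perimeter E)%E.
Proof.
have [c0 d0] := C1c_field0 R.
apply: ereal_sup_ubound; exists (0 : R * R -> R * R).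
  by rewrite test_fieldE; split=> // x;
    rewrite norm2_le//= expr0n/= addr0 expr1n.
by under eq_integral do rewrite d0; rewrite integral0.
Qed.

(** [phi / K] is a test field. Compactness of [C] and finite area make the divergence integrable, so
    that [K] can cross the integral. *)
Lemma integral_divergence_le (R : realType) (phi : R * R -> R * R) (K : R)
    (C : set (R * R)) (E : set (plane R)) :
  C1c_field phi -> 0 < K -> (forall x, norm2 (phi x) <= K) ->
  compact C -> E `<=` C -> measurable E -> (area E < +oo)%E ->
  (\int[lebesgue2 R]_(x in E) (divergence phi x)%:E
   <= K%:E * perimeter E)%E.
Proof.
move=> cphi K0 phiK cC EC mE aE.
pose c := K^-1; have c0 : 0 < c by rewrite invr_gt0.
(* The scaled field is written as a pullback by the identity, so that the regularity of pullbacks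
   applies to it. *)
pose psi := affine_map (c, 0) (0, c) 0 \o phi \o affine_map (1, 0) (0, 1) 0.
have psiE x : psi x = (c * (phi x).1, c * (phi x).2).
  rewrite /psi /affine_map/= !mulr0 !addr0 !add0r !mulr1 (mulrC c) (mulrC c).
  by case: x => a b /=; case: (phi _).
have psi1 : C1c_field psi.
  by apply: C1c_field_pullback => //; rewrite /cross/=
    mulr1 mulr0 subr0 oner_neq0.
have tpsi : test_field psi.
  rewrite test_fieldE; split=> // x; rewrite psiE norm2_le//=.
  have := phiK x; rewrite norm2_le ?(ltW K0)// => h.
  have -> : (c * (phi x).1) ^+ 2 + (c * (phi x).2) ^+ 2 =
    c ^+ 2 * ((phi x).1 ^+ 2 + (phi x).2 ^+ 2) by ring.
  by rewrite /c exprVn mulrC ler_pdivrMr ?exprn_gt0// expr1n mul1r.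
have divE x : divergence psi x = c * divergence phi x.
  have [d _ _ _] := cphi.
  rewrite /divergence.
  have [_ ->] := derive_pullback (c, 0) (0, c) (1, 0)
    (d (affine_map (1, 0) (0, 1) 0 x)).
  have [_ ->] := derive_pullback (c, 0) (0, c) (0, 1)
    (d (affine_map (1, 0) (0, 1) 0 x)).
  have e (v : R * R) : affine_map (1, 0) (0, 1) 0 v = v.
    by rewrite /affine_map/= !mulr0 !addr0 !add0r !mulr1; case: v.
  rewrite !e; move: ('D_(1, 0) phi x) ('D_(0, 1) phi x) => [a1 a2] [b1 b2].
  by rewrite /affine_map/=; ring.
have h : (\int[lebesgue2 R]_(x in E) (divergence psi x)%:E <= perimeter E)%E.
  by apply: ereal_sup_ubound; exists psi.
rewrite -(@lee_pmul2l _ c%:E) ?lte_fin// muleA -EFinM mulVf ?gt_eqF// mul1e.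
rewrite -integralZl//; last first.
  by apply: (integrable_continuous2 (continuous_divergence cphi) cC).
by under eq_integral do rewrite -EFinM -divE.
Qed.

(** If all the images violated the bound, each would have a test field of flux above [K / n.+1]
    times the perimeter of [E]. Pulled back to [E] and added, these fields have length at most [K]
    and total flux above [K] times that perimeter, a contradiction. The columns [p' k], [q' k] are
    those of the inverse linear part. *)
Lemma perimeter_affine_le (R : realType) n (p q t p' q' : 'I_n.+1 -> R * R)
    (K : R) (C : set (R * R)) (E : set (plane R)) :
  (forall k, `|cross (p k) (q k)| = 1) ->
  (forall k, affine_map (p k) (q k) 0 (p' k) = (1, 0)) ->
  (forall k, affine_map (p k) (q k) 0 (q' k) = (0, 1)) -> 0 < K ->
  (forall w : 'I_n.+1 -> R * R, (forall k, norm2 (w k) <= 1) ->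
     norm2 (\sum_k affine_map (p' k) (q' k) 0 (w k)) <= K) ->
  compact C -> E `<=` C -> measurable E -> (area E < +oo)%E ->
  exists k, (perimeter (affine_map (p k) (q k) (t k) @` E) <=
    (K / n.+1%:R)%:E * perimeter E)%E.
Proof.
move=> d1 e1 e2 K0 wK cC EC mE aE; apply: contrapT => H.
have d0 k : cross (p k) (q k) != 0 by rewrite -normr_gt0 d1.
have L0 : 0 < K / n.+1%:R by rewrite divr_gt0.
(* An infinite perimeter would make the bound trivial for any index. *)
have Pfin : perimeter E \is a fin_num.
  rewrite ge0_fin_numE ?perimeter_ge0//; apply: contra_notT H.
  rewrite -leNgt leye_eq => /eqP Ey; exists ord0.
  by rewrite Ey gt0_muley ?lte_fin// leey.
have /choice[phi Hphi] k : exists phi, test_field phi /\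
   ((K / n.+1%:R)%:E * perimeter E < \int[lebesgue2 R]_(x in affine_map (p k)
     (q k) (t k) @` E) (divergence phi x)%:E)%E.
  have : ((K / n.+1%:R)%:E * perimeter E < perimeter
    (affine_map (p k) (q k) (t k) @` E))%E.
    by rewrite ltNge; apply/negP => h; apply: H; exists k.
  by move=> /ereal_sup_gt[_ [f tf <-] h]; exists f.
have cphi k : C1c_field (phi k) by have [/test_fieldE[]] := Hphi k.
have dphi k x : differentiable (phi k) x by have [] := cphi k.
pose psi k := affine_map (p' k) (q' k) 0 \o phi k \o affine_map (p k) (q k)
  (t k).
have cpsi k : C1c_field (psi k) by apply: C1c_field_pullback;
  [exact: d0|exact: cphi].
have divpsi k x : divergence (psi k) x =
  divergence (phi k) (affine_map (p k) (q k) (t k) x).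
  exact: (divergence_pullback _ _ (e1 k) (e2 k) (dphi k)).
have [cS dS] := C1c_field_sum (index_enum 'I_n.+1) cpsi.
have SK x : norm2 ((\sum_k psi k) x) <= K.
  rewrite fct_sumE; apply: (wK (fun k => phi k
    (affine_map (p k) (q k) (t k) x))) => k.
  by have [/test_fieldE[_ h] _] := Hphi k; exact: h.
have := integral_divergence_le cS K0 SK cC EC mE aE.
apply/negP; rewrite -ltNge.
under eq_integral do rewrite dS -sumEFin.
have intpsi k := integrable_continuous2 (continuous_divergence (cpsi k)) cC EC
  mE aE.
rewrite integral_sum//.
have -> : (K%:E * perimeter E = \sum_(k < n.+1) (K / n.+1%:R)%:E * perimeter
  E)%E.
  rewrite -(fineK Pfin) -EFinM sumEFin sumr_const card_ord.
  by congr EFin; rewrite -[RHS]mulr_natr [RHS]mulrAC divfK// pnatr_eq0.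
have Hk (k : 'I_n.+1) : ((K / n.+1%:R)%:E * perimeter E <
  \int[lebesgue2 R]_(x in E) (divergence (psi k) x)%:E)%E.
  have [_] := Hphi k.
  have mdiv : measurable_fun (setT : set (plane R)) (divergence (phi k)).
    by apply: continuous_measurable_fun2; exact: continuous_divergence.
  rewrite (integral_affine (d1 k) mE mdiv).
    by have -> : divergence (psi k) = divergence (phi k) \o affine_map (p k)
      (q k) (t k)
      by apply/funext => x; exact: divpsi.
  by under eq_fun do rewrite -divpsi; exact: intpsi.
have fk (k : 'I_n.+1) : (\int[lebesgue2 R]_(x in E) (divergence (psi k) x)%:E)%E
  \is a fin_num.
  exact: (integrable_fin_num mE (intpsi k)).
rewrite -(fineK Pfin) -EFinM sumEFin.
under [ltRHS]eq_bigr do rewrite -(fineK (fk _)).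
rewrite sumEFin lte_fin ltr_sum//; last by move=> k _;
  rewrite -lte_fin EFinM !fineK.
by apply/hasP; exists ord0 => //; rewrite mem_index_enum.
Qed.

(** Each competitor [E] in [Omega] has one image, with an index depending on [E], that is a
    competitor in [Omega'] of the same area and of controlled perimeter. *)
Lemma cheeger_affine_le (R : realType) n (p q t p' q' : 'I_n.+1 -> R * R)
    (K : R) (C Omega Omega' : set (R * R)) :
  (forall k, `|cross (p k) (q k)| = 1) ->
  (forall k, affine_map (p k) (q k) 0 (p' k) = (1, 0)) ->
  (forall k, affine_map (p k) (q k) 0 (q' k) = (0, 1)) -> 0 < K ->
  (forall w : 'I_n.+1 -> R * R, (forall k, norm2 (w k) <= 1) ->
     norm2 (\sum_k affine_map (p' k) (q' k) 0 (w k)) <= K) ->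
  compact C -> Omega `<=` C -> measurable (Omega : set (plane R)) ->
  (area Omega < +oo)%E ->
  (forall k, affine_map (p k) (q k) (t k) @` Omega `<=` Omega') ->
  (cheeger Omega' <= (K / n.+1%:R)%:E * cheeger Omega)%E.
Proof.
move=> d1 e1 e2 K0 wK cC OC mO aO sub.
have L0 : 0 < K / n.+1%:R by rewrite divr_gt0.
rewrite -lee_pdivrMl//; apply: le_ereal_inf_tmp => _ [E [EO mE aE0] <-].
rewrite lee_pdivrMl//.
have mE' : measurable (E : set (plane R)) by [].
have aE : (area E < +oo)%E.
  apply: le_lt_trans aO; rewrite /area.
  by apply: (le_measure (lebesgue2 R)); rewrite ?inE.
have [k hk] := perimeter_affine_le t d1 e1 e2 K0 wK cC (subset_trans EO OC) mE'
  aE.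
apply: (@le_trans _ _ (perimeter (affine_map (p k) (q k) (t k) @` E)
   / area (affine_map (p k) (q k) (t k) @` E))%E).
  apply: ereal_inf_lbound; exists (affine_map (p k) (q k) (t k) @` E) => //;
    split.
  - by apply: subset_trans (sub k) => _ [x Ex <-]; exists x => //; exact: EO.
  - exact: (image_affine_measurable (t k) (d1 k) mE').
  - by rewrite (area_affine (t k) (d1 k) mE').
rewrite (area_affine (t k) (d1 k) mE') muleA; apply: lee_wpmul2r => //.
by rewrite inve_ge0 ltW.
Qed.

(** Calibration: for every competitor [E], the flux of [phi] is at least [kappa] times the area and
    at most [K] times the perimeter. *)
Lemma cheeger_ge_field (R : realType) (phi : R * R -> R * R) (K kappa : R)
    (C Omega : set (R * R)) :
  C1c_field phi -> 0 < K -> (forall x, norm2 (phi x) <= K) -> 0 <= kappa ->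
  (forall x, Omega x -> kappa <= divergence phi x) ->
  compact C -> Omega `<=` C -> measurable (Omega : set (plane R)) ->
  (area Omega < +oo)%E ->
  ((kappa / K)%:E <= cheeger Omega)%E.
Proof.
move=> cphi K0 phiK kappa0 divk cC OC mO aO.
apply: le_ereal_inf_tmp => _ [E [EO mE aE0] <-].
have mE' : measurable (E : set (plane R)) by [].
have aE : (area E < +oo)%E.
  apply: le_lt_trans aO; rewrite /area.
  by apply: (le_measure (lebesgue2 R)); rewrite ?inE.
have afin : area E \is a fin_num by rewrite ge0_fin_numE// ltW.
have h := integral_divergence_le cphi K0 phiK cC (subset_trans EO OC) mE' aE.
have a0 : 0 < fine (area E) by rewrite -lte_fin fineK.
rewrite -(fineK afin) inver gt_eqF// lee_pdivlMr// -EFinM.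
rewrite mulrAC mulrC EFinM lee_pdivrMl//; apply: le_trans h.
have -> : ((kappa * fine (area E))%:E =
  \int[lebesgue2 R]_(x in E) (cst kappa%:E x))%E.
  by rewrite integral_cst// EFinM fineK.
apply: le_integral => //.
- exact: (integrable_continuous2 (fun _ => cvg_cst kappa) cC
    (subset_trans EO OC) mE' aE).
- exact: (integrable_continuous2 (continuous_divergence cphi) cC
    (subset_trans EO OC) mE' aE).
- by move=> x /[!inE] Ex; rewrite lee_fin; apply/divk/EO.
Qed.

(** * Finiteness of the Cheeger constant *)

Lemma differentiable_slice2 (R : realType) (phi : R * R -> R * R) (x y : R) :
  differentiable phi (x, y) ->
  is_diff y (fun s => (phi (x, s)).2) (fun h => ('d phi (x, y) (0, h)).2).
Proof.
move=> dphi.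
have d1 : is_diff y (fun s : R => (x, s)) (fun h => (0, h)).
  exact: (is_diff_pair (is_diff_cst x y) (is_diff_id y)).
have d2 : is_diff (x, y) phi ('d phi (x, y)) by exact: DiffDef.
exact: (is_diff_comp (is_diff_comp d1 d2) (is_diff_snd _)).
Qed.

Lemma differentiable_slice1 (R : realType) (phi : R * R -> R * R) (x y : R) :
  differentiable phi (x, y) ->
  is_diff x (fun s => (phi (s, y)).1) (fun h => ('d phi (x, y) (h, 0)).1).
Proof.
move=> dphi.
have d1 : is_diff x (fun s : R => (s, y)) (fun h => (h, 0)).
  exact: (is_diff_pair (is_diff_id x) (is_diff_cst y x)).
have d2 : is_diff (x, y) phi ('d phi (x, y)) by exact: DiffDef.
exact: (is_diff_comp (is_diff_comp d1 d2) (is_diff_fst _)).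
Qed.

Lemma FTC2_diff (R : realType) (F f : R -> R) (c d : R) : c < d ->
  continuous f -> (forall y, exists g : R -> R, is_diff y F g /\ g 1 = f y) ->
  (\int[@lebesgue_measure R]_(y in `[c, d]) (f y)%:E = (F d)%:E - (F c)%:E)%E.
Proof.
move=> cd cf dF.
have cF : continuous F.
  move=> y; have [g [[df _] _]] := dF y; exact: differentiable_continuous.
apply: continuous_FTC2 => //.
- exact: continuous_subspaceT.
- split.
  + move=> y _; have [g [[df _] _]] := dF y; exact/derivable1_diffP.
  + exact/cvg_at_right_filter/cF.
  + exact/cvg_at_left_filter/cF.
- move=> y _; have [g [[df dE] g1]] := dF y.
  by rewrite (derive1E' df) dE.
Qed.

Lemma norm_coord_le (R : realType) (x : R * R) : norm2 x <= 1 ->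
  `|x.1| <= 1 /\ `|x.2| <= 1.
Proof.
rewrite norm2_le// expr1n => h.
by split; rewrite -(@ler_pXn2r _ 2)// ?nnegrE// expr1n real_normK ?num_real//;
  apply: le_trans h; rewrite ?lerDl ?lerDr sqr_ge0.
Qed.

(** By the fundamental theorem of calculus only two values of a component remain, each at most 1 in
    absolute value. *)
Lemma slice_integral2 (R : realType) (phi : R * R -> R * R) (x c d : R) :
  test_field phi -> c < d ->
  (`| \int[@lebesgue_measure R]_(y in `[c, d])
    ('D_((0, 1) : R * R) phi (x, y)).2%:E | <= 2%:E)%E.
Proof.
move=> [dphi _ c2 _ phi1] cd.
have cx : continuous (fun s : R => (x, s)).
  move=> y; have [h _] := is_diff_pair (is_diff_cst x y) (is_diff_id y).
  exact: differentiable_continuous h.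
have csnd (y : R * R) : {for y, continuous (snd : R * R -> R)} by exact:
  cvg_snd.
rewrite (@FTC2_diff _ (fun s => (phi (x, s)).2)
  (fun s => ('D_((0, 1) : R * R) phi (x, s)).2))//.
- rewrite -EFinB abse_EFin lee_fin (le_trans (ler_normB _ _))//.
  by rewrite -[2]/(1 + 1) lerD//; exact: (norm_coord_le (phi1 _)).2.
- move=> y.
  exact: (continuous_comp (continuous_comp (cx y) (c2 _)) (csnd _)).
- move=> y; exists (fun h => ('d phi (x, y) (0, h)).2); split.
    exact: differentiable_slice2.
  by rewrite deriveE.
Qed.

Lemma slice_integral1 (R : realType) (phi : R * R -> R * R) (y c d : R) :
  test_field phi -> c < d ->
  (`| \int[@lebesgue_measure R]_(x in `[c, d])
    ('D_((1, 0) : R * R) phi (x, y)).1%:E | <= 2%:E)%E.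
Proof.
move=> [dphi c1 _ _ phi1] cd.
have cx : continuous (fun s : R => (s, y)).
  move=> x; have [h _] := is_diff_pair (is_diff_id x) (is_diff_cst y x).
  exact: differentiable_continuous h.
have cfst (z : R * R) : {for z, continuous (fst : R * R -> R)} by exact:
  cvg_fst.
rewrite (@FTC2_diff _ (fun s => (phi (s, y)).1)
  (fun s => ('D_((1, 0) : R * R) phi (s, y)).1))//.
- rewrite -EFinB abse_EFin lee_fin (le_trans (ler_normB _ _))//.
  by rewrite -[2]/(1 + 1) lerD//; exact: (norm_coord_le (phi1 _)).1.
- move=> x.
  exact: (continuous_comp (continuous_comp (cx x) (c1 _)) (cfst _)).
- move=> x; exists (fun h => ('d phi (x, y) (h, 0)).1); split.
    exact: differentiable_slice1.
  by rewrite deriveE.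
Qed.

Lemma integral_le_support (R : realType) (G : R -> \bar R) (a b M : R) :
  a < b -> 0 <= M ->
  measurable_fun (setT : set (measurableTypeR R)) G ->
    (forall x, x \notin `[a, b] -> G x = 0%E) ->
  (forall x, (`|G x| <= M%:E)%E) ->
  (\int[@lebesgue_measure R]_x G x <= (M * (b - a))%:E)%E.
Proof.
move=> ab M0 mG G0 GM.
have -> : G = G \_ `[a, b].
  apply/funext => x; rewrite patchE; case: ifPn => // /negP xab.
  by rewrite G0//; apply/negP => h; apply: xab; rewrite inE.
rewrite -integral_mkcond; apply: le_trans (lee_abs _) _.
have mab : measurable (`[a, b]%classic : set (measurableTypeR R)) by exact:
  measurable_itv.
apply: le_trans (le_abse_integral _ _ _) _ => //; first exact: measurable_funTS.
apply: le_trans (integral_le_bound (M%:E) _ _ _ _) _ => //.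
- exact: measurable_funTS.
- by apply: aeW => x _.
- by rewrite [X in (_ * X)%E]lebesgue_measure_itv/= lte_fin ab -EFinB -EFinM.
Qed.

Section box.
Variables (R : realType) (a b c d : R).
Hypotheses (ab : a < b) (cd : c < d).
Let E : set (plane R) := `[a, b]%classic `*` `[c, d]%classic.

Let mE : measurable E. Proof. by apply: measurableX; exact: measurable_itv. Qed.

Lemma area_box : area E = ((b - a) * (d - c))%:E.
Proof.
transitivity (@lebesgue_measure R `[a, b]%classic * @lebesgue_measure R
  `[c, d]%classic)%E.
  by apply: product_measure1E; exact: measurable_itv.
have h x y : x < y -> @lebesgue_measure R `[x, y]%classic = (y - x)%:E.
  by move=> xy; rewrite lebesgue_measure_itv/= lte_fin xy -EFinB.
by rewrite !h// EFinM.
Qed.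

Let compact_box : compact (`[a, b]%classic `*` `[c, d]%classic : set (R * R)).
Proof. by apply: compact_setX; exact: segment_compact. Qed.

(** Each term of the divergence is integrated first along its own direction, where the slice
    contributes at most 2, and then over the other side of the box. *)
Lemma perimeter_box : (perimeter E <= (2 * (d - c) + 2 * (b - a))%:E)%E.
Proof.
apply: ge_ereal_sup => _ [phi tphi <-].
have [dphi c1 c2 _ phi1] := tphi.
have cfst (z : R * R) : {for z, continuous (fst : R * R -> R)} by exact:
  cvg_fst.
have csnd (z : R * R) : {for z, continuous (snd : R * R -> R)} by exact:
  cvg_snd.
pose g1 (x : R * R) := ('D_((1, 0) : R * R) phi x).1.
pose g2 (x : R * R) := ('D_((0, 1) : R * R) phi x).2.
have cg1 : continuous g1 by move=> x; exact: (continuous_comp (c1 x) (cfst _)).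
have cg2 : continuous g2 by move=> x; exact: (continuous_comp (c2 x) (csnd _)).
have aE : (area E < +oo)%E by rewrite area_box ltry.
have i1 := integrable_continuous2 cg1 compact_box (fun x h => h) mE aE.
have i2 := integrable_continuous2 cg2 compact_box (fun x h => h) mE aE.
have -> : (\int[lebesgue2 R]_(x in E) (divergence phi x)%:E
  = \int[lebesgue2 R]_(x in E) (g1 x)%:E
  + \int[lebesgue2 R]_(x in E) (g2 x)%:E)%E.
  by rewrite -(integralD_EFin mE i1 i2).
rewrite EFinD; apply: leeD.
(* Extension by zero puts the integral in the form required by Fubini's theorem on the whole
   plane. *)
- have j1 : (lebesgue2 R).-integrable setT ((EFin \o g1) \_ E).
    exact: (integrable_mkcond _ mE).1.
  have -> : (\int[lebesgue2 R]_(x in E) (g1 x)%:E =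
    \int[@lebesgue_measure R]_y \int[@lebesgue_measure R]_x ((EFin \o g1) \_ E)
      (x, y))%E.
    by rewrite integral_mkcond; apply: esym; exact: (integral21_prod_meas1 j1).
  apply: integral_le_support => //; first exact: (measurable_fubini_G j1).
    move=> y yN; apply: integral0_eq => x _.
    rewrite patchE ifF//; apply/negbTE/negP; rewrite inE => -[_ /= h].
    by move/negP: yN; apply.
  move=> y; have [ycd|ycd] := boolP (y \in `[c, d]).
    rewrite (_ : (\int[@lebesgue_measure R]_x ((EFin \o g1) \_ E) (x, y) =
      \int[@lebesgue_measure R]_(x in `[a, b]) (g1 (x, y))%:E)%E);
        first exact: slice_integral1.
    rewrite [RHS]integral_mkcond; apply: eq_integral => x _.
    rewrite !patchE; congr (if _ then _ else _); apply/idP/idP.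
      by rewrite !inE => -[].
    by rewrite !inE.
  rewrite integral0_eq ?abse0// => x _.
  rewrite patchE ifF//; apply/negbTE/negP; rewrite inE => -[_ /= h].
  by move/negP: ycd; apply.
- have j2 : (lebesgue2 R).-integrable setT ((EFin \o g2) \_ E).
    exact: (integrable_mkcond _ mE).1.
  have -> : (\int[lebesgue2 R]_(x in E) (g2 x)%:E =
    \int[@lebesgue_measure R]_x \int[@lebesgue_measure R]_y ((EFin \o g2) \_ E)
      (x, y))%E.
    by rewrite integral_mkcond; apply: esym; exact: (integral12_prod_meas1 j2).
  apply: integral_le_support => //; first exact: (measurable_fubini_F j2).
    move=> x xN; apply: integral0_eq => y _.
    rewrite patchE ifF//; apply/negbTE/negP; rewrite inE => -[/= h _].
    by move/negP: xN; apply.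
  move=> x; have [xab|xab] := boolP (x \in `[a, b]).
    rewrite (_ : (\int[@lebesgue_measure R]_y ((EFin \o g2) \_ E) (x, y) =
      \int[@lebesgue_measure R]_(y in `[c, d]) (g2 (x, y))%:E)%E);
        first exact: slice_integral2.
    rewrite [RHS]integral_mkcond; apply: eq_integral => y _.
    rewrite !patchE; congr (if _ then _ else _); apply/idP/idP.
      by rewrite !inE => -[].
    by rewrite !inE.
  rewrite integral0_eq ?abse0// => y _.
  rewrite patchE ifF//; apply/negbTE/negP; rewrite inE => -[/= h _].
  by move/negP: xab; apply.
Qed.

Lemma box_cheeger (U : set (R * R)) : E `<=` U -> (cheeger U < +oo)%E.
Proof.
move=> EU; apply: le_lt_trans (ereal_inf_lbound _) _.
  exists E; last reflexivity.
  by split=> //; rewrite area_box lte_fin mulr_gt0// subr_gt0.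
rewrite area_box.
have h : (0 < (b - a) * (d - c)) by rewrite mulr_gt0// subr_gt0.
have : perimeter E \is a fin_num.
  by rewrite ge0_fin_numE ?perimeter_ge0//; apply: le_lt_trans perimeter_box _;
    rewrite ltry.
by move=> /fineK <-; rewrite inver gt_eqF// -EFinM ltry.
Qed.

End box.

(** A small box around a point of [U] is a competitor of finite perimeter. *)
Lemma cheeger_lty (R : realType) (U : set (R * R)) : open U -> U !=set0 ->
  (cheeger U < +oo)%E.
Proof.
move=> oU [x Ux].
have /nbhs_ballP[e /= e0 eU] : nbhs x U by move: oU; rewrite openE; apply.
have e2 : 0 < e / 2 by rewrite divr_gt0.
apply: (@box_cheeger R (x.1 - e / 2) (x.1 + e / 2) (x.2 - e / 2) (x.2 + e / 2)).
- lra.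
- lra.
- move=> y [] /=; rewrite !in_itv/= => /andP[h1 h2] /andP[h3 h4].
  by apply: eU; split; rewrite /ball/= ltr_norml; apply/andP; split; lra.
Qed.

(** * Rotations of finite order *)

(** The real form of a geometric sum: shifting the index by one shows that the vector of the two
    sums is fixed by the rotation of angle [b], which is not the identity. *)
Lemma sum_cos_sin_eq0 (R : realType) (N : nat) (b : R) :
  cos b != 1 -> cos (N%:R * b) = 1 -> sin (N%:R * b) = 0 ->
  \sum_(k < N) cos (k%:R * b) = 0 /\ \sum_(k < N) sin (k%:R * b) = 0.
Proof.
move=> b1 cN sN; set C := \sum_(k < N) cos _; set S := \sum_(k < N) sin _.
have shiftE (f : R -> R) : f (N%:R * b) = f 0 ->
    \sum_(k < N) f (k.+1%:R * b) = \sum_(k < N) f (k%:R * b).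
  move=> fN; apply: (@addrI _ (f 0)).
  have h1 : \sum_(k < N.+1) f (k%:R * b) = f 0 + \sum_(k < N) f (k.+1%:R * b).
    by rewrite big_ord_recl mul0r.
  by rewrite -h1 big_ord_recr/= fN addrC.
have SE : cos b * S + sin b * C = S.
  rewrite -[RHS](shiftE sin) ?sN ?sin0// !mulr_sumr -big_split/=.
  by apply: eq_bigr => k _; rewrite -natr1 mulrDl mul1r sinD; ring.
have CE : cos b * C - sin b * S = C.
  rewrite -[RHS](shiftE cos) ?cN ?cos0// !mulr_sumr -sumrB/=.
  by apply: eq_bigr => k _; rewrite -natr1 mulrDl mul1r cosD; ring.
have cs := cos2Dsin2 b.
(* This is the determinant of the identity minus the rotation of angle [b]. *)
have d0 : (1 - cos b) ^+ 2 + sin b ^+ 2 != 0.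
  have -> : (1 - cos b) ^+ 2 + sin b ^+ 2 = 2 * (1 - cos b).
    by rewrite -[X in 2 * (X - _)]cs; nra.
  by rewrite mulf_neq0// subr_eq0 eq_sym.
have CE' : (1 - cos b) * C = - (sin b * S) by lra.
have SE' : (1 - cos b) * S = sin b * C by lra.
split; apply: (mulfI d0); rewrite mulr0 mulrDl !expr2 -!mulrA.
  by rewrite CE' -SE'; ring.
by rewrite SE' mulrCA CE'; ring.
Qed.

Definition rot (R : realType) (a : R) : R * R -> R * R :=
  affine_map (cos a, sin a) (- sin a, cos a) 0.

Lemma rotNK (R : realType) (a : R) : cancel (rot (- a)) (rot a).
Proof.
move=> v; have cs := cos2Dsin2 a; rewrite /rot /affine_map/= cosN sinN.
rewrite [RHS]surjective_pairing -[v.1 in RHS]mul1r -[v.2 in RHS]mul1r -cs.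
by congr pair; ring.
Qed.

Definition dot (R : realType) (x y : R * R) : R := x.1 * y.1 + x.2 * y.2.

Section rotations.
Variables (R : realType) (N : nat) (hN : (3 <= N)%N).
Let b : R := 2 * pi / N%:R.

Let Nn0 : N%:R != 0 :> R. Proof. by rewrite pnatr_eq0; case: N hN. Qed.

Let Nb : N%:R * b = 2 * pi.
Proof. by rewrite /b mulrCA mulfV// mulr1. Qed.

(** Here three sides matter: [b] lies strictly between 0 and [pi], so that neither [b] nor [2 * b]
    is a full turn. *)
Lemma sin_turn_gt0 : 0 < sin b.
Proof.
apply: sin_gt0_pi; rewrite /b divr_gt0 ?mulr_gt0 ?pi_gt0 ?ltr0n//=;
  last by case: N hN.
rewrite ltr_pdivrMr ?ltr0n//; last by case: N hN.
by rewrite mulrC ltr_pM2l ?pi_gt0// ltr_nat.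
Qed.

Let cos2pi : cos (2 * pi : R) = 1.
Proof. by rewrite -[2]/(1 + 1) mulrDl !mul1r cosD cospi sinpi; ring. Qed.
Let sin2pi : sin (2 * pi : R) = 0.
Proof. by rewrite -[2]/(1 + 1) mulrDl !mul1r sinD cospi sinpi; ring. Qed.

Lemma sum_turn1 : \sum_(k < N) cos (k%:R * b) = 0 /\
  \sum_(k < N) sin (k%:R * b) = 0.
Proof.
apply: sum_cos_sin_eq0; rewrite ?Nb//.
apply/eqP => c1; have := cos2Dsin2 b; have := sin_turn_gt0; rewrite c1; nra.
Qed.

Lemma sum_turn2 : \sum_(k < N) cos (k%:R * (2 * b)) = 0 /\
  \sum_(k < N) sin (k%:R * (2 * b)) = 0.
Proof.
have e (x : R) : 2 * x = x + x by ring.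
apply: sum_cos_sin_eq0.
- apply/eqP; rewrite e cosD => c1; have := cos2Dsin2 b; have := sin_turn_gt0;
    nra.
- by rewrite mulrCA Nb (e (2 * pi)) cosD cos2pi sin2pi; ring.
- by rewrite mulrCA Nb (e (2 * pi)) sinD cos2pi sin2pi; ring.
Qed.

(** The square is a constant plus multiples of the cosines and sines of [k b] and [2 k b], whose
    sums over [k] vanish. With [s = 0] this bounds lengths of fields; the shift [s] serves the
    moments about a displaced point. *)
Lemma sum_sqr_dot_rot (w x : R * R) (s : R) :
  \sum_(k < N) (dot w (rot (k%:R * b) x) - s) ^+ 2 =
  N%:R * ((w.1 ^+ 2 + w.2 ^+ 2) * (x.1 ^+ 2 + x.2 ^+ 2) / 2 + s ^+ 2).
Proof.
(* [dot w (rot t x) = A cos t + B sin t]. *)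
pose A := w.1 * x.1 + w.2 * x.2; pose B := w.2 * x.1 - w.1 * x.2.
pose Q := (w.1 ^+ 2 + w.2 ^+ 2) * (x.1 ^+ 2 + x.2 ^+ 2) / 2 + s ^+ 2.
have e (k : 'I_N) : (dot w (rot (k%:R * b) x) - s) ^+ 2 =
   Q + (A ^+ 2 - B ^+ 2) / 2 * cos (k%:R * (2 * b)) + A * B * sin
     (k%:R * (2 * b))
   - 2 * s * A * cos (k%:R * b) - 2 * s * B * sin (k%:R * b).
  have -> : k%:R * (2 * b) = k%:R * b + k%:R * b by ring.
  rewrite cosD sinD /dot /rot /affine_map/= /A /B /Q.
  have := cos2Dsin2 (k%:R * b).
  set c := cos _; set d := sin _ => cd.
  have -> : (w.1 ^+ 2 + w.2 ^+ 2) * (x.1 ^+ 2 + x.2 ^+ 2) / 2 =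
     (w.1 ^+ 2 + w.2 ^+ 2) * (x.1 ^+ 2 + x.2 ^+ 2) / 2 * (c ^+ 2 + d ^+ 2).
    by rewrite cd mulr1.
  by field.
rewrite -/Q; move: Q e => Q e.
rewrite (eq_bigr _ (fun k _ => e k)) !sumrB !big_split/= -!mulr_sumr.
have [-> ->] := sum_turn1; have [-> ->] := sum_turn2.
by rewrite !mulr0 !addr0 !subr0 sumr_const card_ord mulr_natl.
Qed.

(** Let [S] have columns [sp], [sq] and let [z] be the sum. Moving the rotations and [S] to the
    other factor of the scalar product, [|z|^2] is the sum of [<y_k, w_k>] with [y_k = S^T g^k z].
    Then [2 |z| <y_k, w_k> <= |z|^2 + |y_k|^2], and the [|y_k|^2] add up to [N F |z|^2 / 2], where
    [F] is the sum of the squared entries of [S]. The inequality of means keeps the bound free of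
    square roots. *)
Lemma norm_sum_rot_le (sp sq : R * R) (w : 'I_N -> R * R) :
  (forall k, norm2 (w k) <= 1) ->
  norm2 (\sum_(k < N) rot (- (k%:R * b)) (affine_map sp sq 0 (w k))) <=
  N%:R * ((1 + (sp.1 ^+ 2 + sp.2 ^+ 2 + (sq.1 ^+ 2 + sq.2 ^+ 2)) / 2) / 2).
Proof.
move=> w1; set z := \sum_(k < N) _; set F := _ + (_ + _).
have [t0|t0] := eqVneq (norm2 z) 0.
  by rewrite t0 mulr_ge0// divr_ge0// addr_ge0// divr_ge0// !addr_ge0// sqr_ge0.
have tp : 0 < norm2 z by rewrite lt_def t0 norm2_ge0.
pose y1 (k : 'I_N) := dot sp (rot (k%:R * b) z) - 0.
pose y2 (k : 'I_N) := dot sq (rot (k%:R * b) z) - 0.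
have z1 : z.1 = \sum_(k < N) (rot (- (k%:R * b)) (affine_map sp sq 0 (w k))).1.
  by rewrite /z (big_morph fst (id1 := 0) (op1 := +%R)).
have z2 : z.2 = \sum_(k < N) (rot (- (k%:R * b)) (affine_map sp sq 0 (w k))).2.
  by rewrite /z (big_morph snd (id1 := 0) (op1 := +%R)).
have zz : norm2 z ^+ 2 = \sum_(k < N) (y1 k * (w k).1 + y2 k * (w k).2).
  rewrite sqr_norm2 !expr2 {2}z1 {2}z2 !mulr_sumr -big_split/=.
  apply: eq_bigr => k _; rewrite /y1 /y2 /dot /rot /affine_map/= cosN sinN;
    ring.
have hk (k : 'I_N) : 2 * norm2 z * (y1 k * (w k).1 + y2 k * (w k).2) <=
    norm2 z ^+ 2 + (y1 k ^+ 2 + y2 k ^+ 2).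
  have := w1 k; rewrite norm2_le// expr1n; case: (w k) => u v /= uv.
  move: (y1 k) (y2 k) (norm2 z) => a c t.
  have h1 : (a * u + c * v) ^+ 2 <= a ^+ 2 + c ^+ 2.
    have : 0 <= (a * v - c * u) ^+ 2 by exact: sqr_ge0.
    have : 0 <= (a ^+ 2 + c ^+ 2) * (1 - (u ^+ 2 + v ^+ 2)).
      by apply: mulr_ge0; [rewrite addr_ge0// sqr_ge0|rewrite subr_ge0].
    nra.
  have : 0 <= (t - (a * u + c * v)) ^+ 2 by exact: sqr_ge0.
  nra.
have hs : 2 * norm2 z * norm2 z ^+ 2 <=
  N%:R * norm2 z ^+ 2 + N%:R * (F / 2) * norm2 z ^+ 2.
  rewrite {1}zz mulr_sumr; apply: (le_trans (ler_sum _ (fun k _ => hk k))).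
  rewrite !big_split/= sumr_const card_ord -mulr_natl !sum_sqr_dot_rot
    -(sqr_norm2 z).
  by rewrite le_eqVlt; apply/orP; left; apply/eqP; rewrite /F expr0n/=; field.
have n2 : 0 < norm2 z ^+ 2 by rewrite exprn_gt0.
rewrite -(ler_pM2r n2); nra.
Qed.

(** The maps [T g^k], with [g] the turn about [c] and [T] of columns [tp], [tq], send [Omega] into
    [T(Omega)] by symmetry. The linear parts of their inverses are rotations by [- k b] after
    [T^-1], so the previous bound supplies the constant. *)
Lemma cheeger_stretch_le (c tp tq sp sq : R * R) (C Omega : set (R * R)) :
  `|cross tp tq| = 1 ->
  affine_map tp tq 0 sp = (1, 0) -> affine_map tp tq 0 sq = (0, 1) ->
  (forall (k : nat) x, Omega x -> Omega (c + rot (k%:R * b) (x - c))) ->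
  compact C -> Omega `<=` C -> measurable (Omega : set (plane R)) ->
  (area Omega < +oo)%E ->
  (cheeger (affine_map tp tq 0%R @` Omega) <=
   ((1 + (sp.1 ^+ 2 + sp.2 ^+ 2 + (sq.1 ^+ 2 + sq.2 ^+ 2)) / 2) / 2)%:E
   * cheeger Omega)%E.
Proof.
move=> d1 e1 e2 sym cC OC mO aO; set L := _ / 2.
case: N hN Nb Nn0 sym norm_sum_rot_le => // n _ _ Nn0' sym nle.
(* The translation part of the rotation about [c]. *)
pose rt (k : 'I_n.+1) := c - rot (k%:R * b) c.
have comp (k : 'I_n.+1) x : affine_map tp tq 0 (c + rot (k%:R * b) (x - c)) =
    affine_map (affine_map tp tq 0 (cos (k%:R * b), sin (k%:R * b)))
               (affine_map tp tq 0 (- sin (k%:R * b), cos (k%:R * b)))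
               (affine_map tp tq 0 (rt k)) x.
  by rewrite /rt /rot /affine_map/=; congr pair; ring.
have rotrot (k : 'I_n.+1) v : affine_map
  (affine_map tp tq 0 (cos (k%:R * b), sin (k%:R * b)))
  (affine_map tp tq 0 (- sin (k%:R * b), cos (k%:R * b))) 0
    (rot (- (k%:R * b)) v)
  = affine_map tp tq 0 v.
  rewrite -[in RHS](rotNK (k%:R * b) v) /rot /affine_map/=.
  by congr pair; ring.
have -> : L = (n.+1%:R * L) / n.+1%:R by rewrite mulrAC mulfV// mul1r.
apply: (cheeger_affine_le
     (p := fun k => affine_map tp tq 0 (cos (k%:R * b), sin (k%:R * b)))
     (q := fun k => affine_map tp tq 0 (- sin (k%:R * b), cos (k%:R * b)))
     (p' := fun k => rot (- (k%:R * b)) sp)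
     (q' := fun k => rot (- (k%:R * b)) sq)
     (t := fun k => affine_map tp tq 0 (rt k))) cC OC mO aO _.
- move=> k; rewrite cross_affine_map normrM d1 mul1r /cross/=
    mulrN opprK -!expr2.
  by rewrite cos2Dsin2 normr1.
- by move=> k; rewrite rotrot.
- by move=> k; rewrite rotrot.
- by rewrite mulr_gt0 ?ltr0n// /L divr_gt0// ltr_pwDl// divr_ge0// !addr_ge0//
    sqr_ge0.
- move=> w w1.
  rewrite (eq_bigr (fun k : 'I_n.+1 => rot (- (k%:R * b))
    (affine_map sp sq 0 (w k)))).
    exact: nle.
  by move=> k _; rewrite /rot /affine_map/=; congr pair; ring.
- move=> k _ [x Ox <-]; rewrite -comp; exists (c + rot (k%:R * b) (x - c)) =>
    //.
  exact: sym.
Qed.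

End rotations.

(** * Isometries and second moments *)

Definition sqn (R : realType) (x : R * R) : R := x.1 ^+ 2 + x.2 ^+ 2.

(** By polarization the three distances determine the scalar products of [v] with [p] and [q]; the
    difference between [v] and [x.1 p + x.2 q] then has length zero. With [p], [q] the images of the
    standard basis, this makes a distance-preserving map affine. *)
Lemma orthonormal_coord (R : realType) (x p q v : R * R) :
  sqn p = 1 -> sqn q = 1 -> dot p q = 0 -> sqn v = sqn x ->
  sqn (v - p) = sqn (x - (1, 0)) -> sqn (v - q) = sqn (x - (0, 1)) ->
  v.1 = x.1 * p.1 + x.2 * q.1 /\ v.2 = x.1 * p.2 + x.2 * q.2.
Proof.
rewrite /sqn /dot/=.
case: x p q v => [x1 x2] [p1 p2] [q1 q2] [v1 v2] /= sp sq dpq sv svp svq.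
have vp : v1 * p1 + v2 * p2 = x1 by nra.
have vq : v1 * q1 + v2 * q2 = x2 by nra.
have : (v1 - (x1 * p1 + x2 * q1)) ^+ 2 + (v2 - (x1 * p2 + x2 * q2)) ^+ 2 = 0.
  transitivity (v1 ^+ 2 + v2 ^+ 2 + x1 ^+ 2 * (p1 ^+ 2 + p2 ^+ 2)
     + x2 ^+ 2 * (q1 ^+ 2 + q2 ^+ 2) + 2 * x1 * x2 * (p1 * q1 + p2 * q2)
     - 2 * x1 * (v1 * p1 + v2 * p2) - 2 * x2 * (v1 * q1 + v2 * q2));
         first by ring.
  by rewrite sp sq dpq sv vp vq; ring.
move/eqP; rewrite paddr_eq0 ?sqr_ge0// !sqrf_eq0 !subr_eq0 =>
  /andP[/eqP -> /eqP ->].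
by [].
Qed.

Lemma rigid_motion_affine (R : realType) (rho : R * R -> R * R) :
  rigid_motion rho -> exists p q t : R * R,
  [/\ rho = affine_map p q t, sqn p = 1, sqn q = 1 & dot p q = 0].
Proof.
move=> H.
have sq x y : sqn (rho x - rho y) = sqn (x - y).
  by rewrite /sqn -!sqr_norm2; congr (_ ^+ 2); exact: H.
pose p := rho (1, 0) - rho 0; pose q := rho (0, 1) - rho 0.
have sp : sqn p = 1 by rewrite sq /sqn/= subr0 subr0 expr1n expr0n addr0.
have sq' : sqn q = 1 by rewrite sq /sqn/= !subr0 expr1n expr0n add0r.
have spq : sqn (p - q) = 2.
  rewrite /p /q opprB addrA subrK sq /sqn/= subr0 sub0r sqrrN !expr1n.
  by rewrite -[2]/(1 + 1).
have dpq : dot p q = 0.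
  by move: sp sq' spq; rewrite /sqn /dot/=; case: p => p1 p2;
    case: q => q1 q2 /=; nra.
exists p, q, (rho 0); split=> //; apply/funext => x.
pose v := rho x - rho 0.
have sv : sqn v = sqn x by rewrite sq subr0.
have svp : sqn (v - p) = sqn (x - (1, 0)) by rewrite /v /p opprB addrA subrK sq.
have svq : sqn (v - q) = sqn (x - (0, 1)) by rewrite /v /q opprB addrA subrK sq.
suff vE : v.1 = x.1 * p.1 + x.2 * q.1 /\ v.2 = x.1 * p.2 + x.2 * q.2.
  rewrite -[LHS](subrK (rho 0)) -/v /affine_map -vE.1 -vE.2.
  by case: v {sv svp svq vE}; case: (rho 0).
exact: orthonormal_coord.
Qed.

Lemma orthonormal_cross (R : realType) (p q : R * R) :
  sqn p = 1 -> sqn q = 1 -> dot p q = 0 -> `|cross p q| = 1.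
Proof.
rewrite /sqn /dot /cross => sp sq dpq.
have h : (p.1 * q.2 - p.2 * q.1) ^+ 2 = 1.
  transitivity ((p.1 ^+ 2 + p.2 ^+ 2) * (q.1 ^+ 2 + q.2 ^+ 2) -
    (p.1 * q.1 + p.2 * q.2) ^+ 2).
    by ring.
  by rewrite sp sq dpq; ring.
by apply/eqP; rewrite -sqrp_eq1// real_normK ?num_real// h.
Qed.

(** A square matrix with orthonormal columns has orthonormal rows, so its transpose preserves
    lengths too. *)
Lemma orthonormal_transpose (R : realType) (p q u : R * R) :
  sqn p = 1 -> sqn q = 1 -> dot p q = 0 -> dot u p ^+ 2 + dot u q ^+ 2 = sqn u.
Proof.
move=> sp sq dpq; have := orthonormal_cross sp sq dpq.
move: sp sq dpq; rewrite /sqn /dot /cross.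
case: p q u => [p1 p2] [q1 q2] [u1 u2] /= sp sq dpq cr.
have c2 : (p1 * q2 - p2 * q1) ^+ 2 = 1 by rewrite -real_normK ?num_real// cr
  expr1n.
have : p1 ^+ 2 + q1 ^+ 2 = 1 /\ p2 ^+ 2 + q2 ^+ 2 = 1 /\ p1 * p2 + q1 * q2 = 0.
  (* [p] is a quarter turn of [q] multiplied by the determinant, which is a sign. *)
  have e1 : (p1 - q2 * (p1 * q2 - p2 * q1)) = 0.
    transitivity (p1 * (1 - (q1 ^+ 2 + q2 ^+ 2)) + q1 * (p1 * q1 + p2 * q2));
      first by ring.
    by rewrite sq dpq; ring.
  have e2 : (p2 + q1 * (p1 * q2 - p2 * q1)) = 0.
    transitivity (p2 * (1 - (q1 ^+ 2 + q2 ^+ 2)) + q2 * (p1 * q1 + p2 * q2));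
      first by ring.
    by rewrite sq dpq; ring.
  set d := p1 * q2 - p2 * q1 in c2 e1 e2.
  have -> : p1 = q2 * d by lra.
  have -> : p2 = - (q1 * d) by lra.
  split; [|split].
  - by transitivity (q2 ^+ 2 * d ^+ 2 + q1 ^+ 2); [ring|rewrite c2 mulr1 addrC].
  - by transitivity (q1 ^+ 2 * d ^+ 2 + q2 ^+ 2); [ring|rewrite c2 mulr1].
  - by transitivity (- (q1 * q2) * d ^+ 2 + q1 * q2); [ring|rewrite c2; ring].
move=> [h1 [h2 h3]].
transitivity (u1 ^+ 2 * (p1 ^+ 2 + q1 ^+ 2) + u2 ^+ 2 * (p2 ^+ 2 + q2 ^+ 2)
   + 2 * u1 * u2 * (p1 * p2 + q1 * q2)); first by ring.
by rewrite h1 h2 h3; ring.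
Qed.

Lemma sqn_ge0 (R : realType) (x : R * R) : 0 <= sqn x.
Proof. by rewrite addr_ge0// sqr_ge0. Qed.

Lemma dot_sqr_le (R : realType) (x y : R * R) : dot x y ^+ 2 <= sqn x * sqn y.
Proof.
rewrite -subr_ge0 /dot /sqn.
have -> : (x.1 ^+ 2 + x.2 ^+ 2) * (y.1 ^+ 2 + y.2 ^+ 2) -
  (x.1 * y.1 + x.2 * y.2) ^+ 2
  = (x.1 * y.2 - x.2 * y.1) ^+ 2 by ring.
exact: sqr_ge0.
Qed.

Lemma norm2_triangle (R : realType) (x y : R * R) :
  norm2 (x + y) <= norm2 x + norm2 y.
Proof.
rewrite norm2_le ?addr_ge0 ?norm2_ge0//.
have h : dot x y <= norm2 x * norm2 y.
  apply: le_trans (ler_norm _) _.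
  rewrite -(@ler_pXn2r _ 2)// ?nnegrE ?mulr_ge0 ?norm2_ge0//.
  by rewrite real_normK ?num_real// exprMn !sqr_norm2; exact: dot_sqr_le.
rewrite [(norm2 x + _) ^+ 2]sqrrD !sqr_norm2; move: h; rewrite /dot.
move: (norm2 x * norm2 y) => n h.
have -> : (x + y).1 ^+ 2 + (x + y).2 ^+ 2 = x.1 ^+ 2 + x.2 ^+ 2
  + (x.1 * y.1 + x.2 * y.2) *+ 2 + (y.1 ^+ 2 + y.2 ^+ 2).
  by rewrite /= mulr2n; ring.
by rewrite lerD2r lerD2l lerMn2r h orbT.
Qed.

Lemma norm2N (R : realType) (x : R * R) : norm2 (- x) = norm2 x.
Proof. by rewrite /norm2/= !sqrrN. Qed.

Lemma dist_orthonormal (R : realType) (p q t x y : R * R) :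
  sqn p = 1 -> sqn q = 1 -> dot p q = 0 ->
  norm2 (affine_map p q t x - affine_map p q t y) = norm2 (x - y).
Proof.
move=> sp sq pq; congr (Num.sqrt _); rewrite /affine_map/=.
transitivity ((x.1 - y.1) ^+ 2 * sqn p + (x.2 - y.2) ^+ 2 * sqn q
  + 2 * (x.1 - y.1) * (x.2 - y.2) * dot p q); first by rewrite /sqn /dot; ring.
by rewrite sp sq pq; ring.
Qed.

Lemma continuous_coord_sub (R : realType) (c : R * R) :
  continuous (fun x : R * R => (x - c).1) /\
  continuous (fun x : R * R => (x - c).2).
Proof.
split=> x; apply: cvgB; try exact: cvg_cst.
  exact: cvg_fst.
exact: cvg_snd.
Qed.

Lemma continuous_square (R : realType) (f : R * R -> R) :
  continuous f -> continuous (fun x => f x ^+ 2).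
Proof. by move=> cf x; exact: (cvgM (cf x) (cf x)). Qed.

Lemma continuous_sqn (R : realType) (c : R * R) :
  continuous (fun x : R * R => sqn (x - c) / 2).
Proof.
have [c1 c2] := continuous_coord_sub c.
by move=> x; apply: cvgMl; apply: cvgD;
  [exact: continuous_square c1 _|exact: continuous_square c2 _].
Qed.

Lemma continuous_dot (R : realType) (c w : R * R) (s : R) :
  continuous (fun x : R * R => (dot w (x - c) - s) ^+ 2).
Proof.
have [c1 c2] := continuous_coord_sub c.
apply: (@continuous_square _ (fun x => dot w (x - c) - s)) => x.
apply: cvgB; last exact: cvg_cst.
by apply: cvgD; apply: cvgMr; [exact: c1|exact: c2].
Qed.

Section moments.
Variables (R : realType) (N : nat) (hN : (3 <= N)%N).
Let b : R := 2 * pi / N%:R.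
Variables (c : R * R) (C Omega : set (R * R)).
Hypothesis sym : forall k : nat,
  (fun x => c + rot (k%:R * b) (x - c)) @` Omega = Omega.
Hypotheses (cC : compact C) (OC : Omega `<=` C)
  (mO : measurable (Omega : set (plane R))) (aO : area Omega = 1%E).

Local Notation "\Int_ A f" :=
  (\int[lebesgue2 R]_(x in A) (f x)%:E)%E
  (at level 36, A at level 1, f at level 36).

(** Half the polar moment of inertia about [c]: for an isotropic set this is the second moment in
    each direction. *)
Definition half_inertia : R := fine (\Int_Omega (fun x => sqn (x - c) / 2)).

Let csqn := @continuous_sqn R c.
Let cdot := @continuous_dot R c.

Let aOy : (area Omega < +oo)%E. Proof. by rewrite aO ltry. Qed.

Lemma half_inertiaE : \Int_Omega (fun x => sqn (x - c) / 2) = half_inertia%:E.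
Proof.
by rewrite fineK//; apply: integrable_fin_num => //;
  exact: (integrable_continuous2 csqn cC OC).
Qed.

(** As [Omega] is invariant under the turns about [c], the integrand may be replaced by its mean
    over them, which depends only on the distance to [c]. The term [s ^+ 2] is the parallel axis
    theorem for unit area. *)
Lemma isotropic_moment (w : R * R) (s : R) :
  (\Int_Omega (fun x => (dot w (x - c) - s) ^+ 2) =
  (sqn w * half_inertia + s ^+ 2)%:E)%E.
Proof.
pose f x := (dot w (x - c) - s) ^+ 2.
have cf : continuous f by exact: cdot.
have mf := continuous_measurable_fun2 cf.
have If : \Int_Omega f \is a fin_num.
  by apply: integrable_fin_num => //; exact: (integrable_continuous2 cf cC OC).
have N0 : (N%:R : R) != 0 by rewrite pnatr_eq0; case: N hN.
pose g (k : nat) := affine_map (cos (k%:R * b), sin (k%:R * b))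
   (- sin (k%:R * b), cos (k%:R * b)) (c - rot (k%:R * b) c).
have gE k x : g k x = c + rot (k%:R * b) (x - c).
  by rewrite /g [RHS]surjective_pairing /rot /affine_map/=; congr pair; ring.
have gO k : g k @` Omega = Omega.
  by rewrite -[RHS](sym k); congr (_ @` _); apply/funext => x; exact: gE.
have Ik (k : nat) : \Int_Omega f = \Int_Omega (fun x => f (g k x)).
  rewrite -{1}(gO k) ge0_integral_affine//.
  - by rewrite /cross/= mulrN opprK -!expr2 cos2Dsin2 normr1.
  - by move=> x; exact: sqr_ge0.
have mfg (k : nat) : measurable_fun Omega (fun x : plane R => (f (g k x))%:E).
  have cfg : continuous (fun x => f (g k x)).
    by move=> x; apply: (continuous_comp (g := f));
      [exact: continuous_affine|exact: cf].
  exact: (measurable_int _ (integrable_continuous2 cfg cC OC mO aOy)).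
have H1 : (\sum_(k < N) \Int_Omega f = \Int_Omega
  (fun x => N%:R * (sqn w * (sqn (x - c) / 2) + s ^+ 2)))%E.
  rewrite (eq_bigr _ (fun (k : 'I_N) _ => Ik k)).
  have f0 (k : 'I_N) (x : plane R) : Omega x -> (0 <= (f (g k x))%:E)%E.
    by move=> _; rewrite lee_fin sqr_ge0.
  have hs := @ge0_integral_sum _ _ _ (lebesgue2 R)
    Omega mO 'I_N (fun k x => (f (g k x))%:E) (fun k => mfg k) f0
      (index_enum 'I_N).
  apply: (etrans (esym hs)).
  apply: eq_integral => x _; rewrite sumEFin; congr EFin.
  rewrite mulrA -(sum_sqr_dot_rot hN).
  apply: eq_bigr => k _; rewrite /f gE; congr ((dot w _ - s) ^+ 2).
  by rewrite addrC addKr.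
have H2 : \Int_Omega (fun x => N%:R * (sqn w * (sqn (x - c) / 2) + s ^+ 2)) =
  (N%:R * (sqn w * half_inertia + s ^+ 2))%:E.
  pose k1 : R := N%:R * sqn w; pose k2 : R := N%:R * s ^+ 2.
  have ih := integrable_continuous2 csqn cC OC mO aOy.
  have c1 : continuous (fun x : R * R => k1 * (sqn (x - c) / 2)).
    by move=> x; apply: cvgMr; exact: csqn.
  have c2 : continuous (fun x : R * R => k2) by move=> x; exact: cvg_cst.
  have i1 := integrable_continuous2 c1 cC OC mO aOy.
  have i2 := integrable_continuous2 c2 cC OC mO aOy.
  transitivity (\Int_Omega (fun x => k1 * (sqn (x - c) / 2) + k2)).
    by apply: eq_integral => x _; congr EFin; rewrite /k1 /k2; ring.
  rewrite (integralD_EFin mO i1 i2).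
  have -> : \Int_Omega (fun=> k2) = k2%:E.
    rewrite integral_cst//; transitivity (k2%:E * area Omega)%E => //.
    by rewrite aO mule1.
  have -> : \Int_Omega (fun x => k1 * (sqn (x - c) / 2)) =
    (k1 * half_inertia)%:E.
    by rewrite EFinM -half_inertiaE -integralZl.
  by rewrite -EFinD; congr EFin; rewrite /k1 /k2; ring.
have : (N%:R * fine (\Int_Omega f))%:E =
  (N%:R * (sqn w * half_inertia + s ^+ 2))%:E.
  rewrite -H2 -H1 -{2}(fineK If) sumEFin sumr_const card_ord; congr EFin.
  exact: mulr_natl.
by move=> [/(mulfI N0) <-]; rewrite fineK.
Qed.

Lemma half_inertia_gt0 : 0 < half_inertia.
Proof.
(* As [Omega] has unit area, most of it lies outside the square of area 1/4
   centered at [c]. *)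
pose d : R := 1 / 4.
pose Q : set (plane R) := `[c.1 - d, c.1 + d]%classic `*`
  `[c.2 - d, c.2 + d]%classic.
have mQ : measurable Q by apply: measurableX; exact: measurable_itv.
have aQ : area Q = (1 / 4)%:E.
  by rewrite area_box /d; [congr EFin; field|lra|lra].
have mD : measurable (Omega `\` Q : set (plane R)) by exact: measurableD.
have aD : ((3 / 4)%:E <= area (Omega `\` Q))%E.
  have h : (1 <= area (Omega `\` Q) + (1 / 4)%:E)%E.
    rewrite -aQ -aO; apply: (@le_trans _ _ (area ((Omega `\` Q) `|` Q))).
      apply: (le_measure (lebesgue2 R)); rewrite ?inE//.
        exact: measurableU.
      by move=> x Ox; have [xQ|xQ] := pselect (Q x); [right|left].
    exact: (measureU2 (lebesgue2 R)).
  have -> : (3 / 4)%:E = (1 - (1 / 4)%:E)%E :> \bar R.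
    by rewrite -EFinB; congr EFin; field.
  by rewrite leeBlDr.
rewrite -lte_fin -half_inertiaE.
have mh : measurable_fun (setT : set (plane R))
  (EFin \o (fun x : R * R => sqn (x - c) / 2)).
  by apply/measurable_EFinP; exact: (continuous_measurable_fun2 csqn).
apply: (@lt_le_trans _ _ ((1 / 32)%:E * area (Omega `\` Q))%E).
  by rewrite mule_gt0// ?lte_fin ?divr_gt0//; apply: lt_le_trans aD;
    rewrite lte_fin divr_gt0.
have -> : ((1 / 32)%:E * area (Omega `\` Q) =
  \int[lebesgue2 R]_(x in Omega `\` Q) (cst (1 / 32)%:E x))%E.
  by rewrite integral_cst//; exact: measurableD.
apply: (@le_trans _ _ (\Int_(Omega `\` Q) (fun x => sqn (x - c) / 2))).
  apply: ge0_le_integral => //.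
  - by move=> x _; rewrite lee_fin divr_ge0.
  - exact: (measurable_funTS mh).
  - move=> x [_ xQ]; rewrite lee_fin.
    rewrite leNgt; apply/negP => h; apply: xQ; move: h;
      rewrite /sqn /Q /d/= => h.
    have key (y z : R) : (y ^+ 2 + z ^+ 2) / 2 < 1 / 32 -> - (1 / 4) <= y <=
      1 / 4.
      move=> yz; rewrite -ler_norml -(@ler_pXn2r _ 2)// ?nnegrE ?divr_ge0//.
      by rewrite real_normK ?num_real//; have := sqr_ge0 z; lra.
    have /andP[h1 h2] := key _ _ h; move: h; rewrite addrC => /key/andP[h3 h4].
    by split; rewrite /= in_itv/=; apply/andP; split; lra.
apply: ge0_subset_integral => //.
- exact: (measurable_funTS mh).
- by move=> x _; rewrite lee_fin divr_ge0// addr_ge0// sqr_ge0.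
Qed.

(** Weigh points by [f], the squared distance in direction [u] from the center of [B]. The integral
    of [f] over [B] is [half_inertia], and over [A] it is at least [a2] times that. The excess can
    only come from the points of [A] outside [B], where [f] is at most [(2 * r1 + r0) ^+ 2] once [A]
    and [B] meet. *)
Lemma area_symdiff_ge (tp tq u p q t : R * R) (r0 r1 : R) :
  let A := affine_map tp tq 0 @` Omega in
  let B := affine_map p q t @` Omega in
  let a2 := dot u tp ^+ 2 + dot u tq ^+ 2 in
  `|cross tp tq| = 1 -> sqn p = 1 -> sqn q = 1 -> dot p q = 0 -> sqn u = 1 ->
  (forall x, Omega x -> norm2 (x - c) <= r0) ->
  (forall x, Omega x -> norm2 (affine_map tp tq 0 x - affine_map tp tq 0 c) <=
    r1) ->
  (1 <= area (A `\` B))%E \/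
  (((a2 - 1) * half_inertia)%:E <= ((2 * r1 + r0) ^+ 2)%:E * area (A `\` B))%E.
Proof.
move=> A B a2 d1 sp sq pq su O0 O1.
have dpq := orthonormal_cross sp sq pq.
have mA : measurable (A : set (plane R)) by exact: image_affine_measurable.
have mB : measurable (B : set (plane R)) by exact: image_affine_measurable.
have mAB : measurable (A `\` B : set (plane R)) by exact: measurableD.
have [/set0P AB0|/negPn/eqP AB0] := boolP (A `&` B != set0); last first.
  left; rewrite setDE.
  have -> : A `&` ~` B = A.
    apply/seteqP; split=> x; first by case.
    move=> Ax; split=> // Bx; have : (A `&` B) x by [].
    by rewrite AB0.
  by rewrite /A area_affine// aO.
right.
pose cB := affine_map p q t c.
pose f x := (dot u (x - cB)) ^+ 2.
have cf : continuous f.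
  by move=> x; have := @continuous_dot R cB u 0 x; rewrite /f;
    under eq_fun do rewrite subr0.
have mf := continuous_measurable_fun2 cf.
have f0 x : 0 <= f x by exact: sqr_ge0.
have IB : \Int_B f = half_inertia%:E.
  rewrite /B ge0_integral_affine//.
  rewrite -[half_inertia]mul1r -su -(orthonormal_transpose u sp sq pq).
  have := isotropic_moment (dot u p, dot u q) 0.
  rewrite expr0n addr0 => <-; apply: eq_integral => x _; congr EFin.
  by rewrite /f /cB /dot /affine_map/= subr0; congr (_ ^+ 2); ring.
have IA : ((a2 * half_inertia)%:E <= \Int_A f)%E.
  rewrite /A ge0_integral_affine//.
  pose s := dot u (cB - affine_map tp tq 0 c).
  have := isotropic_moment (dot u tp, dot u tq) s.
  have -> : \Int_Omega (fun x => (dot (dot u tp, dot u tq) (x - c) - s) ^+ 2) =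
     \Int_Omega (fun x => f (affine_map tp tq 0 x)).
    apply: eq_integral => x _; congr EFin.
    by rewrite /f /s /dot /affine_map/=; congr (_ ^+ 2); ring.
  move=> ->; rewrite lee_fin /a2 lerDl; exact: sqr_ge0.
have fR x : A x -> f x <= (2 * r1 + r0) ^+ 2.
  have [y [[y' Oy' y'y] [z Oz zy]]] := AB0 => -[x' Ox' <-].
  apply: le_trans (dot_sqr_le _ _) _; rewrite su mul1r /sqn -sqr_norm2.
  (* The path runs from a point of [A] to the center of [A], on to a common point of [A] and [B],
     and then to the center of [B]. *)
  have h : norm2 (affine_map tp tq 0 x' - cB) <= 2 * r1 + r0.
    have -> : affine_map tp tq 0 x' - cB =
      (affine_map tp tq 0 x' - affine_map tp tq 0 c)
      + (- (affine_map tp tq 0 y' - affine_map tp tq 0 c)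
         + (affine_map p q t z - affine_map p q t c)).
      by rewrite y'y zy opprB -/cB; rewrite addrA subrKA addrA subrK.
    apply: le_trans (norm2_triangle _ _) _;
      rewrite -[2]/(1 + 1) mulrDl mul1r -addrA.
    apply: lerD (O1 _ Ox') _.
    apply: le_trans (norm2_triangle _ _) _;
      rewrite norm2N (dist_orthonormal t z c sp sq pq).
    by apply: lerD; [exact: O1|exact: O0].
  by rewrite ler_pXn2r// ?nnegrE ?norm2_ge0// (le_trans (norm2_ge0 _) h).
have mfT (D : set (plane R)) : measurable_fun D (EFin \o f).
  by apply: measurable_funTS; apply/measurable_EFinP.
have h : (\Int_A f <= \Int_B f + ((2 * r1 + r0) ^+ 2)%:E * area (A `\` B))%E.
  have AE : A = (A `&` B) `|` (A `\` B) by rewrite setDE -setIUr setUv setIT.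
  have mI : measurable (A `&` B : set (plane R)) by exact: measurableI.
  have AD : [disjoint A `&` B & A `\` B].
    by apply/disj_setPS => x [[_ ?] []].
  have := @ge0_integral_setU _ _ _ (lebesgue2 R)
    _ _ mI mAB (EFin \o f) (mfT _) _ AD.
  rewrite -AE => ->; last by move=> x _; rewrite lee_fin.
  apply: leeD.
    apply: ge0_subset_integral => //.
    by move=> x _; rewrite lee_fin.
  have -> : (((2 * r1 + r0) ^+ 2)%:E * area (A `\` B) =
    \int[lebesgue2 R]_(x in A `\` B) (cst ((2 * r1 + r0) ^+ 2)%:E x))%E.
    by rewrite integral_cst.
  apply: ge0_le_integral => //.
  - by move=> x _; rewrite lee_fin.
  - by move=> x [Ax _]; rewrite lee_fin; exact: fR.
rewrite mulrBl mul1r EFinB leeBlDl//.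
by apply: le_trans IA _; rewrite -IB.
Qed.

End moments.

(** * A stretching family *)

(** Near a nonzero point the function is [y ^+ 2] or its opposite; at 0 the difference quotient is
    [|h|]. *)
Lemma is_derive_mul_norm (R : realType) (s : R) :
  is_derive s 1 (fun y : R => y * `|y|) (2 * `|s|).
Proof.
have sq (k : R) : is_derive s 1 (fun y : R => k * y ^+ 2) (k * (2 * s)).
  have h := is_deriveX 2 (is_derive_id s (1 : R)).
  have h2 := is_deriveZ k h.
  have -> : (fun y : R => k * y ^+ 2) = k \*:
    ((id : R -> R) ^+ 2) by apply/funext.
  apply: (is_derive_eq h2).
  by rewrite /GRing.scale/= expr1 mulr1; ring.
have [s0|s0|s0] := ltrgtP s 0.
- have -> : 2 * `|s| = -1 * (2 * s) by rewrite ltr0_norm//; ring.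
  apply: near_eq_is_derive (sq (-1)).
  by near=> y; rewrite ltr0_norm; [ring|near: y; exact: lt_nbhsl].
- have -> : 2 * `|s| = 1 * (2 * s) by rewrite gtr0_norm//; ring.
  apply: near_eq_is_derive (sq 1).
  by near=> y; rewrite gtr0_norm; [ring|near: y; exact: lt_nbhsr].
- rewrite s0 normr0 mulr0.
  have cv : (fun h : R => h^-1 *: (((fun y : R => y * `|y|) \o shift 0)
    (h *: (1 : R)) - 0 * `|0 : R|)) @ 0^' --> (0 : R).
    apply: (@cvg_trans _ ((fun h : R => `|h|) @ 0^')).
      apply: near_eq_cvg; near=> h => /=.
      have h0 : h != 0 by near: h; exact: nbhs_dnbhs_neq.
      by rewrite /GRing.scale/= mul0r subr0 addr0 mulr1 mulrA mulVf// mul1r.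
    have := @norm_continuous _ R^o (0 : R); rewrite /continuous_at normr0.
    by apply: cvg_trans; apply: cvg_app; exact: nbhs_dnbhs.
  apply: DeriveDef; first by apply/cvg_ex; exists 0.
  exact: cvg_lim.
Unshelve. all: by end_near. Qed.

(* This is [max(s, 0) ^ 2]; the derivative is [s + |s|]. *)
Definition sqpos (R : realType) (s : R) : R := (s ^+ 2 + s * `|s|) / 2.

Lemma is_diff_sqpos (R : realType) (s : R) :
  is_diff s (@sqpos R) (fun h => h * (s + `|s|)).
Proof.
have h : is_derive s 1 (@sqpos R) (s + `|s|).
  have h := is_deriveX 2 (is_derive_id s (1 : R)).
  have h2 := is_deriveZ 2^-1 (is_deriveD h (is_derive_mul_norm s)).
  have -> : @sqpos R = 2^-1 \*: (id ^+ 2 + (fun y : R => y * `|y|)).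
    by apply/funext => y; rewrite /sqpos /GRing.scale/= mulrC.
  apply: (is_derive_eq h2).
  by rewrite /GRing.scale/= expr1 mulr1 mulr2n; field.
have d : differentiable (@sqpos R) s by apply/derivable1_diffP; case: h.
apply: DiffDef => //.
rewrite diff1E//; apply/funext => k.
by rewrite derive1E; case: h => _ ->.
Qed.

(** The squared positive part is a cutoff that remains continuously differentiable across the unit
    circle. The second component vanishes so that a linear pullback has values along a single
    direction. *)
Definition bump_field (R : realType) (x : R * R) : R * R :=
  (x.1 * sqpos (1 - sqn x), 0).

Lemma is_diff_bump (R : realType) (x : R * R) :
  is_diff x (@bump_field R) (fun h => (h.1 * sqpos (1 - sqn x)
    - 2 * x.1 * (x.1 * h.1 + x.2 * h.2) * ((1 - sqn x) + `|1 - sqn x|), 0)).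
Proof.
have d1 := is_diff_fst x; have d2 := is_diff_snd x.
have du : is_diff x (fun y : R * R => 1 - sqn y)
    (fun h => - (2 * (x.1 * h.1 + x.2 * h.2))).
  have -> : (fun y : R * R => 1 - sqn y) =
    cst 1 - ((fst : R * R -> R) * fst + (snd : R * R -> R) * snd).
    by apply/funext => y; rewrite /= !fctE /sqn !expr2.
  have dD := is_diffD (is_diffM d1 d1) (is_diffM d2 d2).
  have dB := is_diffB (is_diff_cst (1 : R) x) dD.
  apply: (is_diff_eq dB); apply/funext => h.
  transitivity (0 - (x.1 * h.1 + x.1 * h.1 + (x.2 * h.2 + x.2 * h.2)));
    first by [].
  by ring.
have dm := is_diff_comp du (is_diff_sqpos (1 - sqn x)).
have d1m := is_diffM d1 dm.
have dp := is_diff_pair d1m (is_diff_cst (0 : R) x).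
apply: (is_diff_eq dp); apply/funext => h; congr pair.
transitivity (x.1 * (- (2 * (x.1 * h.1 + x.2 * h.2)) *
  (1 - sqn x + `|1 - sqn x|))
  + sqpos (1 - sqn x) * h.1); first by [].
by ring.
Qed.

Lemma derive_bump (R : realType) (x v : R * R) :
  'D_v (@bump_field R) x = (v.1 * sqpos (1 - sqn x)
    - 2 * x.1 * (x.1 * v.1 + x.2 * v.2) * ((1 - sqn x) + `|1 - sqn x|), 0).
Proof.
have [d dE] := is_diff_bump x.
by rewrite (deriveE _ d) dE.
Qed.

Lemma sqpos_eq0 (R : realType) (s : R) : s <= 0 -> sqpos s = 0.
Proof. by move=> s0; rewrite /sqpos ler0_norm//; ring. Qed.

Lemma bump_support (R : realType) (x : R * R) : bump_field x != 0 -> sqn x < 1.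
Proof.
move=> h; rewrite ltNge; apply: contra_neqN h => h.
by rewrite /bump_field sqpos_eq0 ?mulr0// subr_le0.
Qed.

Lemma continuous_pair (R : realType) (f g : R * R -> R) :
  continuous f -> continuous g -> continuous (fun x => (f x, g x)).
Proof. by move=> cf cg x; exact: (cvg_pair (cf x) (cg x)). Qed.

Lemma C1c_field_bump (R : realType) : C1c_field (@bump_field R).
Proof.
have cu : continuous (fun x : R * R => 1 - sqn x).
  move=> x; apply: cvgB; first exact: cvg_cst.
  by apply: cvgD; [exact: (cvgM cvg_fst cvg_fst)|exact: (cvgM cvg_snd cvg_snd)].
have cn : continuous (fun x : R * R => `|1 - sqn x|).
  by move=> x; apply: cvg_norm; exact: cu.
have cs : continuous (fun x : R * R => sqpos (1 - sqn x)).
  move=> x; apply: cvgMl; apply: cvgD; first exact: (cvgM (cu x) (cu x)).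
  exact: (cvgM (cu x) (cn x)).
have cD v : continuous (fun x => 'D_v (@bump_field R) x).
  under eq_fun do rewrite derive_bump.
  apply: continuous_pair => x; last exact: cvg_cst.
  apply: cvgB; first by apply: cvgMr; exact: cs.
  apply: cvgM; last by apply: cvgD; [exact: cu|exact: cn].
  apply: cvgM; first by apply: cvgMr; exact: cvg_fst.
  by apply: cvgD; apply: cvgMl; [exact: cvg_fst|exact: cvg_snd].
split; [|exact: cD|exact: cD|].
  by move=> x; have [d _] := is_diff_bump x.
apply: (compact_support (K := `[-1, 1]%classic `*` `[-1, 1]%classic)).
  by apply: compact_setX; exact: segment_compact.
move=> x /bump_support; rewrite /sqn => h.
have key (y z : R) : y ^+ 2 + z ^+ 2 < 1 -> -1 <= y <= 1.
  move=> yz; rewrite -ler_norml -(@ler_pXn2r _ 2)// ?nnegrE//.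
  by rewrite real_normK ?num_real//; have := sqr_ge0 z; lra.
by split; rewrite /= in_itv/=; [exact: key h|move: h; rewrite addrC;
  exact: key].
Qed.

Lemma bump_le1 (R : realType) (x : R * R) : `|(bump_field x).1| <= 1.
Proof.
have [h|h] := ltP (sqn x) 1; last by rewrite /=
  sqpos_eq0 ?subr_le0// mulr0 normr0.
have u0 : 0 <= 1 - sqn x by rewrite subr_ge0 ltW.
rewrite /= normrM /sqpos (ger0_norm u0).
have x1 : `|x.1| <= 1.
  rewrite -(@ler_pXn2r _ 2)// ?nnegrE// real_normK ?num_real//.
  by move: h; rewrite /sqn; have := sqr_ge0 x.2; lra.
have u1 : 1 - sqn x <= 1 by rewrite gerBl; exact: sqn_ge0.
rewrite -[leRHS](mulr1 1) ler_pM// ger0_norm;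
  last by rewrite divr_ge0// addr_ge0// ?sqr_ge0// mulr_ge0.
by move: (1 - sqn x) u0 u1 => u u0 u1; nra.
Qed.

Lemma divergence_bump_ge (R : realType) (x : R * R) : sqn x <= 1 / 16 ->
  1 / 2 <= divergence (@bump_field R) x.
Proof.
move=> h; rewrite /divergence !derive_bump/= addr0.
have u0 : 0 <= 1 - sqn x by lra.
rewrite /sqpos (ger0_norm u0) !mulr1 mulr0 addr0 mul1r.
have hx : x.1 ^+ 2 <= sqn x by rewrite /sqn lerDl sqr_ge0.
have h0 := sqr_ge0 x.1.
move: (sqn x) h hx u0 => n h hx u0.
(* The right-hand side is at least [(1 - n) (1 - 5 n)], hence at least [165/256] for [n <= 1/16]. *)
apply: (@le_trans _ _ ((1 - n) ^+ 2 - 4 * x.1 ^+ 2 * (1 - n))); first by nra.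
by rewrite le_eqVlt; apply/orP; left; apply/eqP; field.
Qed.

(** The columns of [a e e^T + a^-1 f f^T] with [f = (- e.2, e.1)]; for a unit vector [e], the
    inverse is obtained by replacing [a] with [a^-1]. *)
Definition stretch_col (R : realType) (e : R * R) (a : R) : (R * R) * (R * R) :=
  ((a * e.1 ^+ 2 + a^-1 * e.2 ^+ 2, (a - a^-1) * (e.1 * e.2)),
   ((a - a^-1) * (e.1 * e.2), a * e.2 ^+ 2 + a^-1 * e.1 ^+ 2)).

Definition stretch (R : realType) (e : R * R) (a : R) : R * R -> R * R :=
  affine_map (stretch_col e a).1 (stretch_col e a).2 0.

Section stretch.
Variables (R : realType) (e : R * R) (a : R).
Hypotheses (e1 : sqn e = 1) (a0 : 0 < a).

Let ane0 : a != 0. Proof. by rewrite gt_eqF. Qed.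

Lemma stretch_cross : cross (stretch_col e a).1 (stretch_col e a).2 = 1.
Proof.
rewrite /cross/=; transitivity (sqn e ^+ 2); last by rewrite e1 expr1n.
by rewrite /sqn; field.
Qed.

Lemma stretch_inv :
  stretch e a (stretch_col e a^-1).1 = (1, 0) /\
  stretch e a (stretch_col e a^-1).2 = (0, 1).
Proof.
(* Writing 1 as a form of degree four in [e] turns the claims into polynomial identities. *)
have e1' : sqn e ^+ 2 = 1 by rewrite e1 expr1n.
by split; rewrite /stretch /affine_map/= invrK; congr pair; rewrite -?e1' /sqn;
  field.
Qed.

Lemma stretch_sqn_inv :
  sqn (stretch_col e a^-1).1 + sqn (stretch_col e a^-1).2 = a ^+ 2 + a^-1 ^+ 2.
Proof.
rewrite /sqn/= invrK; transitivity ((a ^+ 2 + a^-1 ^+ 2) * sqn e ^+ 2).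
  by rewrite /sqn; field.
by rewrite e1 expr1n mulr1.
Qed.

Lemma stretch_dot : dot e (stretch_col e a).1 ^+ 2 + dot e
  (stretch_col e a).2 ^+ 2 = a ^+ 2.
Proof.
transitivity (a ^+ 2 * (sqn e) ^+ 3); first by rewrite /dot /sqn/=; field.
by rewrite e1 expr1n mulr1.
Qed.

Lemma stretch_along (d : R) : stretch e a (d * e.1, d * e.2) =
  (a * d * e.1, a * d * e.2).
Proof.
rewrite /stretch /affine_map/= -[RHS]/(a * d * e.1, a * d * e.2).
by congr pair; rewrite -[RHS]mulr1 -e1 /sqn; field.
Qed.

Lemma stretchB x y : stretch e a x - stretch e a y = stretch e a (x - y).
Proof. by rewrite [LHS]surjective_pairing /stretch /affine_map/=; congr pair;
  ring. Qed.

Lemma stretch_norm_le x : 1 <= a -> norm2 (stretch e a x) <= a * norm2 x.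
Proof.
move=> a1; rewrite norm2_le ?mulr_ge0 ?norm2_ge0 ?(ltW a0)// exprMn sqr_norm2.
(* The coordinates of [x] along [e] and across it. *)
pose s := x.1 * e.1 + x.2 * e.2; pose r := - x.1 * e.2 + x.2 * e.1.
have -> : (stretch e a x).1 ^+ 2 + (stretch e a x).2 ^+ 2 =
  a ^+ 2 * s ^+ 2 + a^-1 ^+ 2 * r ^+ 2.
  transitivity ((a ^+ 2 * s ^+ 2 + a^-1 ^+ 2 * r ^+ 2) * sqn e).
    by rewrite /stretch /affine_map/= /s /r /sqn; field.
  by rewrite e1 mulr1.
have -> : x.1 ^+ 2 + x.2 ^+ 2 = s ^+ 2 + r ^+ 2.
  by rewrite -[LHS]mulr1 -e1 /s /r /sqn; ring.
rewrite mulrDr lerD2l ler_wpM2r ?sqr_ge0// ler_pXn2r// ?nnegrE ?invr_ge0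
  ?(ltW a0)//.
by rewrite (le_trans _ a1)// invf_le1.
Qed.

(* The test field is a bump field, rescaled so that its core covers the stretched
   set, of which only the component in the contracted direction is kept. *)
Lemma cheeger_stretch_ge (r0 : R) (c : R * R) (C Omega : set (R * R)) :
  0 < r0 ->
  (forall x, Omega x -> norm2 (x - c) <= r0) -> compact C ->
  stretch e a @` Omega `<=` C ->
  measurable (Omega : set (plane R)) -> (area Omega < +oo)%E ->
  ((a / (8 * r0))%:E <= cheeger (stretch e a @` Omega))%E.
Proof.
move=> r00 Or cC TC mO aO.
(* Scaling by [l] brings the disc of radius [r0] into that of radius [1/4], where the bump field has
   divergence at least [1/2]. *)
have [l lE] : exists l : R, l = (4 * r0)^-1 by exists (4 * r0)^-1.
have l0 : 0 < l by rewrite lE invr_gt0 mulr_gt0.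
have lne0 : l != 0 by rewrite gt_eqF.
(* This map undoes the stretch and scales by [l], with the contracted direction as first coordinate.
   The inverse [p'], [q'] therefore turns the horizontal bump field into one of length at most
   [(l * a)^-1], small for large [a], while the divergence is kept. *)
pose p := (- (l * a * e.2), l / a * e.1); pose q := (l * a * e.1, l / a * e.2).
pose t := - affine_map p q 0 (stretch e a c).
pose p' := (- (e.2 / (l * a)), e.1 / (l * a));
  pose q' := (a / l * e.1, a / l * e.2).
have pE : affine_map p q 0 p' = (1, 0).
  by rewrite /affine_map/=; congr pair; rewrite -?e1 /sqn; field;
    rewrite ?ane0 ?lne0.
have qE : affine_map p q 0 q' = (0, 1).
  by rewrite /affine_map/=; congr pair; rewrite -?e1 /sqn; field;
    rewrite ?ane0 ?lne0.
have cpq : cross p q != 0.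
  have -> : cross p q = - (l ^+ 2).
    by rewrite -[RHS]mulr1 -e1 /cross /sqn/=; field.
  by rewrite oppr_eq0 expf_neq0.
pose psi := affine_map p' q' 0 \o @bump_field R \o affine_map p q t.
have cpsi : C1c_field psi by apply: C1c_field_pullback;
  [exact: cpq|exact: C1c_field_bump].
have psi_le x : norm2 (psi x) <= (l * a)^-1.
  have la0 : 0 < (l * a)^-1 by rewrite invr_gt0 mulr_gt0.
  rewrite norm2_le ?(ltW la0)// /psi /= /affine_map/=.
  have := @bump_le1 R (affine_map p q t x); rewrite /affine_map /=.
  set w := _ * sqpos _ => w1; rewrite !mul0r !addr0.
  have -> : (w * - (e.2 / (l * a))) ^+ 2 + (w * (e.1 / (l * a))) ^+ 2 =
    w ^+ 2 * (l * a)^-1 ^+ 2.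
    by rewrite -[RHS]mulr1 -e1 /sqn; field; rewrite ?ane0 ?lne0.
  rewrite ler_piMl ?sqr_ge0//.
  by rewrite -real_normK ?num_real// exprn_ile1.
have mT : measurable (stretch e a @` Omega : set (plane R)).
  by apply: image_affine_measurable => //; rewrite stretch_cross normr1.
have aT : (area (stretch e a @` Omega) < +oo)%E.
  by rewrite area_affine// stretch_cross normr1.
have -> : a / (8 * r0) = (1 / 2) / (l * a)^-1.
  by rewrite lE; field; rewrite ?ane0 ?gt_eqF.
apply: (cheeger_ge_field (phi := psi) (C := C)) => //.
- by rewrite invr_gt0 mulr_gt0.
- move=> _ [x Ox <-].
  have db : forall x, differentiable (@bump_field R) x by have [] :=
    C1c_field_bump R.
  rewrite (divergence_pullback t _ pE qE db).
  apply: divergence_bump_ge.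
  have -> : affine_map p q t (stretch e a x) =
     (l * (- e.2 * (x - c).1 + e.1 * (x - c).2), l *
       (e.1 * (x - c).1 + e.2 * (x - c).2)).
    rewrite /t /stretch /affine_map/=.
    by congr pair; rewrite -[RHS]mulr1 -e1 /sqn; field.
  have -> : sqn (l * (- e.2 * (x - c).1 + e.1 * (x - c).2), l *
    (e.1 * (x - c).1 + e.2 * (x - c).2)) = l ^+ 2 * norm2 (x - c) ^+ 2.
    by rewrite sqr_norm2 -[RHS]mulr1 -e1 /sqn/=; ring.
  have h : norm2 (x - c) ^+ 2 <= r0 ^+ 2.
    by rewrite ler_pXn2r// ?nnegrE ?norm2_ge0 ?(ltW r00)//; exact: Or.
  have -> : 1 / 16 = l ^+ 2 * r0 ^+ 2 by rewrite lE; field; rewrite gt_eqF.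
  by rewrite ler_wpM2l// sqr_ge0.
Qed.
End stretch.

(** * Polygonal regions and affine maps *)

Section homeomorphism.
Variables (T U : topologicalType) (f : T -> U) (g : U -> T).
Hypotheses (fg : cancel f g) (gf : cancel g f).
Hypotheses (cf : continuous f) (cg : continuous g).

Lemma homeo_connected_component (A : set T) (x : T) :
  f @` connected_component A x = connected_component (f @` A) (f x).
Proof.
have [Ax|Ax] := pselect (A x); last first.
  rewrite !connected_component_out ?image_set0// => -[y Ay /(can_inj fg) yx].
  by rewrite yx in Ay.
apply/seteqP; split.
  apply: connected_component_max.
  - by exists x => //; exact: connected_component_refl.
  - by apply: image_subset; exact: connected_component_sub.
  - apply: connected_continuous_connected; first exact: component_connected.
    exact: continuous_subspaceT.
move=> y hy; exists (g y) => //.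
have h : g @` connected_component (f @` A) (f x) `<=` connected_component A x.
  apply: connected_component_max.
  - exists (f x) => //; apply: connected_component_refl; exact: imageP.
  - move=> _ [z hz <-]; have [w Aw <-] := connected_component_sub hz.
    by rewrite fg.
  - apply: connected_continuous_connected; first exact: component_connected.
    exact: continuous_subspaceT.
by apply: h; exists y.
Qed.

Lemma homeo_interior (A : set T) : (f @` A)° = f @` A°.
Proof.
rewrite -(preimage_can A gf fg).
apply/seteqP; split=> x.
  move=> /= hx; exists (g x) => //.
  have : nbhs (g x) (f @^-1` (g @^-1` A)) by apply: cf; rewrite gf; exact: hx.
  by apply: filterS => y /=; rewrite fg.
move=> [y Ay <-]; apply: cg; rewrite fg; exact: Ay.
Qed.

Lemma homeo_setC (A : set T) : ~` (f @` A) = f @` ~` A.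
Proof.
by rewrite -!(preimage_can _ gf fg).
Qed.

Lemma homeo_closure (A : set T) : closure (f @` A) = f @` closure A.
Proof.
apply/seteqP; split=> x.
  move=> hx; exists (g x) => //; move=> B nB.
  have /hx [y [[z Az <-] By]] : nbhs x (g @^-1` B) by apply: cg.
  by exists z; split=> //; move: By; rewrite /= fg.
move=> [y hy <-] B nB.
have /hy [z [Az Bz]] : nbhs y (f @^-1` B) by apply: cf.
by exists (f z); split=> //; exists z.
Qed.
End homeomorphism.

Lemma boundary_affine (R : realType) (p q t : R * R) (A : set (R * R)) :
  cross p q != 0 -> boundary (affine_map p q t @` A) =
    affine_map p q t @` boundary A.
Proof.
move=> d0; have [p' [q' [t' [dE fg gf]]]] := affine_map_inv t d0.
rewrite /boundary (homeo_closure fg gf); try exact: continuous_affine.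
rewrite (homeo_interior fg gf); try exact: continuous_affine.
by rewrite -!(preimage_can _ gf fg).
Qed.

Lemma bounded_set_box (R : realType) (S : set (R * R)) : bounded_set S ->
  exists2 M : R, 0 < M & S `<=` `[- M, M]%classic `*` `[- M, M]%classic.
Proof.
move=> [M0 [_ H]]; pose M := `|M0| + 1.
have M1 : M0 < M by rewrite ltr_pwDr// ler_norm.
exists M => [|x Sx]; first by rewrite ltr_wpDl.
have := H _ M1 _ Sx => /= h.
have : `|x| = Num.max `|x.1| `|x.2| by [].
move=> xE; move: h; rewrite xE ge_max => /andP[h1 h2].
by split; rewrite /= in_itv/= -ler_norml.
Qed.

Lemma compact_square (R : realType) (M : R) :
  compact (`[- M, M]%classic `*` `[- M, M]%classic : set (R * R)).
Proof. by apply: compact_setX; exact: segment_compact. Qed.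

Lemma bounded_subset (R : realType) (S S' : set (R * R)) :
  S `<=` S' -> bounded_set S' -> bounded_set S.
Proof. by move=> SS [M [Mr H]]; exists M; split=> // x Mx y /SS; exact: H. Qed.

Lemma bounded_affine (R : realType) (p q t : R * R) (S : set (R * R)) :
  bounded_set S -> bounded_set (affine_map p q t @` S).
Proof.
move=> /bounded_set_box[M M0 SM].
apply: (bounded_subset (image_subset _ SM)).
apply: compact_bounded; apply: continuous_compact; last exact: compact_square.
by apply: continuous_subspaceT; exact: continuous_affine.
Qed.

Lemma polygonal_curve_affine (R : realType) N (p q t : R * R)
  (v : 'I_N -> R * R) :
  polygonal_curve (affine_map p q t \o v) =
    affine_map p q t @` polygonal_curve v.
Proof.
have segE (a c : R * R) (s : R) : (1 - s) *: affine_map p q t a + s *: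
  affine_map p q t c =
    affine_map p q t ((1 - s) *: a + s *: c).
  rewrite [LHS]surjective_pairing /affine_map /= /GRing.scale/=; congr pair;
    ring.
apply/seteqP; split.
  by move=> _ [i _ [s s01 <-]]; rewrite segE;
    exists ((1 - s) *: v i + s *: v (ordS i)) => //;
    exists i => //; exists s.
by move=> _ [_ [i _ [s s01 <-]] <-]; exists i => //; exists s => //;
  rewrite segE.
Qed.

(** An invertible affine map is a homeomorphism that preserves boundedness both ways, so it carries
    the bounded components of a complement to bounded components. *)
Lemma polygon_region_affine (R : realType) N (p q t : R * R)
  (v : 'I_N -> R * R) :
  cross p q != 0 ->
  polygon_region (affine_map p q t \o v) = affine_map p q t @` polygon_region v.
Proof.
move=> d0; have [p' [q' [t' [dE fg gf]]]] := affine_map_inv t d0.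
rewrite /polygon_region polygonal_curve_affine.
set f := affine_map p q t; set g := affine_map p' q' t';
  set G := polygonal_curve v.
have cf : continuous f by exact: continuous_affine.
have cg : continuous g by exact: continuous_affine.
have cc x : connected_component (~` (f @` G)) (f x) =
  f @` connected_component (~` G) x.
  by rewrite (homeo_setC fg gf) (homeo_connected_component fg gf cf cg).
apply/seteqP; split=> x.
  move=> [xG bx]; exists (g x) => //; split.
    by move=> gx; apply: xG; exists (g x) => //; rewrite /f gf.
  have : bounded_set (g @` connected_component (~` (f @` G)) x) by exact:
    bounded_affine.
  rewrite -{1}(gf x) cc.
  by apply: bounded_subset => y hy; exists (f y); [exists y|exact: fg].
move=> [y [yG by_] <-]; split.
  by move=> [z Gz /(can_inj fg) zy]; apply: yG; rewrite -zy.
by rewrite cc; exact: bounded_affine.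
Qed.

Lemma connected_segment (R : realType) (a c : R * R) : connected (segment a c).
Proof.
apply: connected_continuous_connected; first exact: segment_connected.
apply: continuous_subspaceT => s; apply: cvgD.
  by apply: cvgZl; apply: cvgB; [exact: cvg_cst|exact: cvg_id].
by apply: cvgZl; exact: cvg_id.
Qed.

Lemma star_connected (R : realType) (B : set (R * R)) (x : R * R) :
  (forall y, B y -> segment x y `<=` B) -> connected B.
Proof.
move=> st.
have BE : B = \bigcup_(y in B) segment x y.
  apply/seteqP; split=> [y By|y [z Bz]]; last exact: st.
  by exists y => //; exists 1; rewrite /= ?in_itv/=
    ?ler01 ?lexx// subrr scale0r add0r scale1r.
rewrite BE; apply: bigcup_connected; last by move=> y _;
  exact: connected_segment.
by exists x => y _; exists 0; rewrite /= ?in_itv/=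
  ?ler01 ?lexx// subr0 scale0r addr0 scale1r.
Qed.

Lemma compact_polygonal_curve (R : realType) N (v : 'I_N -> R * R) :
  compact (polygonal_curve v).
Proof.
have -> : polygonal_curve v = \big[setU/set0]_(i <- enum 'I_N) edge v i.
  rewrite -bigcup_seq; congr bigcup; apply/seteqP; split=> i //= _.
  by rewrite mem_enum.
apply: bigsetU_compact => i _; apply: continuous_compact;
  last exact: segment_compact.
apply: continuous_subspaceT => s; apply: cvgD.
  by apply: cvgZl; apply: cvgB; [exact: cvg_cst|exact: cvg_id].
by apply: cvgZl; exact: cvg_id.
Qed.

(** A ball around [x] that avoids the curve is star-shaped, so it lies in the component of [x]. *)
Lemma open_polygon_region (R : realType) N (v : 'I_N -> R * R) :
  open (polygon_region v).
Proof.
have oC : open (~` polygonal_curve v).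
  by apply: closed_openC; apply: compact_closed;
    [exact: norm_hausdorff|exact: compact_polygonal_curve].
rewrite openE => x [xG bx].
have /nbhs_ballP[r /= r0 rG] : nbhs x (~` polygonal_curve v) by move: oC;
  rewrite openE; apply.
apply/nbhs_ballP; exists r => //= y xy; split; first exact: rG.
suff <- : connected_component (~` polygonal_curve v) x =
  connected_component (~` polygonal_curve v) y by [].
apply: same_connected_component.
apply: (@connected_component_max _ _ (ball x r)) => //; first exact: ballxx.
apply: (@star_connected _ _ x) => z [z1 z2] _ [s s01 <-].
have key (a c : R) : ball a r c -> ball a r ((1 - s) * a + s * c).
  move: s01; rewrite /= in_itv/= => /andP[s0 s1]; rewrite /ball/= => h.
  have -> : a - ((1 - s) * a + s * c) = s * (a - c) by ring.
  by rewrite normrM (ger0_norm s0) (le_lt_trans _ h)// ler_piMl.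
by split; exact: key.
Qed.

(** From a point outside a square containing the curve, the ray away from the origin avoids the
    curve, so the component of that point is unbounded. *)
Lemma bounded_polygon_region (R : realType) N (v : 'I_N -> R * R) :
  bounded_set (polygon_region v).
Proof.
have [M M0 GM] := bounded_set_box (compact_bounded
  (@compact_polygonal_curve R N v)).
exists M; split; first exact: num_real.
move=> K MK x [xG bx]; rewrite /= leNgt; apply/negP => Kx.
have xM : M < `|x| by exact: lt_trans Kx.
pose ray : set (R * R) := (fun s : R => s *: x) @` `[1, +oo[%classic.
have cray : connected ray.
  apply: connected_continuous_connected;
    first exact/connected_intervalP/interval_is_interval.
  by apply: continuous_subspaceT => s; apply: cvgZl; exact: cvg_id.
have rG : ray `<=` ~` polygonal_curve v.
  move=> _ [s s1 <-] /GM [] /=; rewrite !in_itv/= -!ler_norml => h1 h2.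
  move: s1; rewrite /= in_itv/= andbT => s1.
  have : `|s *: x| <= M.
    by rewrite [X in X <= _](_ : _ = Num.max `|(s *: x).1| `|(s *: x).2|)//
      ge_max h1.
  rewrite normrZ ger0_norm ?(le_trans ler01 s1)//; apply/negP; rewrite -ltNge.
  by rewrite (lt_le_trans xM)// ler_peMl.
have rx : ray x by exists 1; rewrite ?scale1r//= in_itv/= lexx.
have := bounded_subset (connected_component_max rx rG cray) bx.
move=> [K' [_ H]].
have x0 : 0 < `|x| by exact: lt_trans xM.
have K'1 : K' < `|K'| + 1 by rewrite ltr_pwDr// ler_norm.
pose s := (`|K'| + 2) / `|x| + 1.
have s1 : 1 <= s by rewrite lerDr divr_ge0// addr_ge0.
have /= := H _ K'1 (s *: x).
have -> : `|s *: x| = `|K'| + 2 + `|x|.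
  by rewrite normrZ ger0_norm ?(le_trans ler01 s1)// mulrDl mul1r divfK//
    gt_eqF.
move=> /(_ _)/wrap[]; first by exists s => //=; rewrite in_itv/= s1.
by apply/negP; rewrite -ltNge -addrA ltrD2l ltr_pwDr//; lra.
Qed.

(** * Regular polygons *)

(** All other vertices lie strictly to the left of each side. The condition is stable under affine
    maps of positive determinant and, for at least three vertices, yields both requirements on an
    N-gon. *)
Definition convex_vertices (R : realType) (N : nat) (v : 'I_N -> R * R) :
  Prop :=
  forall i k : 'I_N, k != i -> k != ordS i ->
    0 < cross (v (ordS i) - v i) (v k - v i).

Lemma ordS_neq (N : nat) (i : 'I_N) : (1 < N)%N -> ordS i != i.
Proof.
move=> N1; apply/eqP => /(congr1 val) /=.
have iN := ltn_ord i.
have [iN1|iN1] := ltnP i.+1 N; first by rewrite modn_small//; lia.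
have e : i.+1 = N by lia.
by rewrite e modnn; lia.
Qed.

Lemma ordSS_neq (N : nat) (i : 'I_N) : (2 < N)%N -> ordS (ordS i) != i.
Proof.
move=> N2; apply/eqP => /(congr1 val) /=.
have iN := ltn_ord i.
have [iN1|iN1] := ltnP i.+1 N.
  rewrite (modn_small iN1).
  have [iN2|iN2] := ltnP i.+2 N; first by rewrite modn_small//; lia.
  have e : i.+2 = N by lia.
  by rewrite e modnn; lia.
have e : i.+1 = N by lia.
by rewrite e modnn modn_small; lia.
Qed.

Lemma convex_genuine_sides (R : realType) (N : nat) (v : 'I_N -> R * R) :
  (2 < N)%N -> convex_vertices v -> genuine_sides v.
Proof.
move=> N2 cv i.
have -> : cross (v (ordS i) - v i) (v (ordS (ordS i)) - v (ordS i)) =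
    cross (v (ordS i) - v i) (v (ordS (ordS i)) - v i) by rewrite /cross/=;
      ring.
rewrite gt_eqF//; apply: cv; first exact: ordSS_neq.
by apply: ordS_neq; exact: ltnW.
Qed.

(** The affine function [F] vanishes on side [i], is positive at the other vertices and is a convex
    combination of two vertex values along side [j]. It vanishes at a common point only if all the
    weight sits on an end point shared with side [i]. *)
Lemma convex_simple_curve (R : realType) (N : nat) (v : 'I_N -> R * R) :
  (2 < N)%N -> convex_vertices v -> simple_curve v.
Proof.
move=> N2 cv i j x ij [s s01 xs] [s' s01' xs'].
move: s01 s01'; rewrite /= !in_itv/= => /andP[s0 s1] /andP[s0' s1'].
pose F (y : R * R) := cross (v (ordS i) - v i) (y - v i).
have Fi : F (v i) = 0 by rewrite /F /cross/=; ring.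
have FSi : F (v (ordS i)) = 0 by rewrite /F /cross/=; ring.
have Faff (a b : R * R) (u : R) : F ((1 - u) *: a + u *: b) =
  (1 - u) * F a + u * F b.
  rewrite /F /cross.
  rewrite -[((1 - u) *: a + u *: b - v i).1]/((1 - u) * a.1 + u * b.1 -
    (v i).1).
  rewrite -[((1 - u) *: a + u *: b - v i).2]/((1 - u) * a.2 + u * b.2 -
    (v i).2).
  by rewrite /=; ring.
have Fx : F x = 0 by rewrite -xs Faff Fi FSi !mulr0 addr0.
have Fx' : (1 - s') * F (v j) + s' * F (v (ordS j)) = 0 by rewrite -Faff xs'.
have Fpos k : k != i -> k != ordS i -> 0 < F (v k) by exact: cv.
have [jSi|jSi] := eqVneq j (ordS i).
  left; split=> //.
  have F2 : 0 < F (v (ordS j)).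
    by apply: Fpos; rewrite jSi; [exact: ordSS_neq|apply: ordS_neq;
      exact: ltnW].
  have : s' = 0.
    move: Fx'; rewrite {1}jSi FSi mulr0 add0r => /eqP.
    by rewrite mulf_eq0 (gt_eqF F2) orbF => /eqP.
  by move=> s'0; rewrite -xs' s'0 subr0 scale1r scale0r addr0.
right.
have Fj : 0 < F (v j) by apply: Fpos => //; rewrite eq_sym.
have FSj : 0 <= F (v (ordS j)).
  have [->|h1] := eqVneq (ordS j) i; first by rewrite Fi.
  have [->|h2] := eqVneq (ordS j) (ordS i); first by rewrite FSi.
  by rewrite ltW// Fpos.
have s'1 : s' = 1.
  apply/eqP; rewrite eq_le s1'/=; apply/negPn/negP; rewrite -ltNge => h.
  have : 0 < (1 - s') * F (v j) by rewrite mulr_gt0// subr_gt0.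
  have : 0 <= s' * F (v (ordS j)) by rewrite mulr_ge0.
  by lra.
have FSj0 : F (v (ordS j)) = 0 by move: Fx';
  rewrite s'1 subrr mul0r add0r mul1r.
have Sji : ordS j = i.
  apply/eqP/negPn/negP => h1.
  have [h2|h2] := eqVneq (ordS j) (ordS i).
    by move: ij; rewrite (ordS_inj h2) eqxx.
  by have := Fpos _ h1 h2; rewrite FSj0 ltxx.
by split=> //; rewrite -xs' s'1 subrr scale0r add0r scale1r Sji.
Qed.

Lemma convex_is_ngon_affine (R : realType) (N : nat) (v : 'I_N -> R * R)
  (p q t : R * R) :
  (2 < N)%N -> 0 < cross p q -> convex_vertices v ->
  is_ngon N (affine_map p q t @` polygon_region v).
Proof.
move=> N2 pq cv.
have cv' : convex_vertices (affine_map p q t \o v).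
  move=> i k ki kSi.
  have -> : cross ((affine_map p q t \o v) (ordS i) - (affine_map p q t \o v) i)
      ((affine_map p q t \o v) k - (affine_map p q t \o v) i) =
      cross p q * cross (v (ordS i) - v i) (v k - v i).
    by rewrite /cross /affine_map/=; ring.
  by rewrite mulr_gt0// cv.
exists (affine_map p q t \o v); split.
- exact: convex_simple_curve.
- exact: convex_genuine_sides.
- by rewrite polygon_region_affine// gt_eqF.
Qed.

Section regular.
Variables (R : realType) (N : nat) (hN : (3 <= N)%N).
Variables (c : R * R) (r theta : R) (r0 : 0 < r).
Let b : R := 2 * pi / N%:R.

(** Vertices indexed by all naturals: the cyclic successor becomes [n.+1], and [N]-periodicity
    absorbs the wrap-around. *)
Let V (n : nat) : R * R :=
  (c.1 + r * cos (theta + n%:R * b), c.2 + r * sin (theta + n%:R * b)).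

Let N0 : N%:R != 0 :> R. Proof. by rewrite pnatr_eq0; case: N hN. Qed.

Let regularE (k : 'I_N) : regular_vertices c r theta k = V k.
Proof.
rewrite /regular_vertices /V.
by have -> : theta + 2 * pi * k%:R / N%:R = theta + k%:R * b by rewrite /b;
  field.
Qed.

Let VN n : V (n + N) = V n.
Proof.
rewrite /V; have -> : theta + (n + N)%:R * b = theta + n%:R * b + pi + pi.
  by rewrite natrD /b; field.
by rewrite !cosDpi !sinDpi !opprK.
Qed.

Let regularS (k : 'I_N) : regular_vertices c r theta (ordS k) = V k.+1.
Proof.
rewrite regularE /=; have kN := ltn_ord k.
have [h|h] := ltnP k.+1 N; first by rewrite modn_small.
have -> : k.+1 = (0 + N)%N by lia.
by rewrite add0n modnn -[in RHS](add0n N) VN.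
Qed.

Let half_turn : R := pi / N%:R.

(** With [h] half the central angle, the cross product of the two chords is
    [4 r^2 sin h sin (m h) sin ((m - 1) h)], and the three angles lie between 0 and [pi]. *)
Let Vcross i m : (2 <= m)%N -> (m < N)%N ->
  0 < cross (V i.+1 - V i) (V (i + m)%N - V i).
Proof.
move=> m2 mN.
pose x := (m%:R - 1) * half_turn; pose h := half_turn.
have h0 : 0 < h by rewrite divr_gt0 ?pi_gt0// ltr0n; case: N hN.
have hpi (k : R) : k < N%:R -> k * h < pi.
  have Np : 0 < N%:R :> R by rewrite ltr0n; case: N hN.
  move=> kN; rewrite /h /half_turn mulrA (ltr_pdivrMr _ _ Np) [pi * _]mulrC.
  by rewrite (ltr_pM2r (pi_gt0 R)).
have s1 : 0 < sin h.
  by apply: sin_gt0_pi; rewrite h0 -[X in X < _]mul1r hpi// ltr1n; lia.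
have s2 : 0 < sin (m%:R * h).
  by apply: sin_gt0_pi; rewrite hpi ?ltr_nat// mulr_gt0 ?ltr0n//; lia.
have s3 : 0 < sin x.
  apply: sin_gt0_pi; rewrite /x -/h; apply/andP; split.
    by rewrite mulr_gt0// subr_gt0 ltr1n; lia.
  by apply: hpi; rewrite ltrBlDr natr1 ltr_nat; lia.
have -> : cross (V i.+1 - V i) (V (i + m)%N - V i) =
   r ^+ 2 * (4 * sin h * sin (m%:R * h) * sin x).
  rewrite /cross /V/=.
  have -> : theta + i.+1%:R * b = theta + i%:R * b + (h + h).
    by rewrite -natr1 /b /h /half_turn; field.
  have -> : theta + (i + m)%:R * b = theta + i%:R * b + (m%:R * h + m%:R * h).
    by rewrite natrD /b /h /half_turn; field.
  have -> : x = m%:R * h - h by rewrite /x /h; ring.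
  move: (theta + i%:R * b) (m%:R * h) => A y.
  have cA := cos2Dsin2 A.
  have chord B B' : (c.1 + r * cos (A + B) - (c.1 + r * cos A)) *
      (c.2 + r * sin (A + B') - (c.2 + r * sin A)) -
      (c.2 + r * sin (A + B) - (c.2 + r * sin A)) *
      (c.1 + r * cos (A + B') - (c.1 + r * cos A)) =
      r ^+ 2 * ((cos B - 1) * sin B' - sin B * (cos B' - 1)).
    rewrite -[RHS]mulr1 -[X in _ = _ * X]cA !cosD !sinD; ring.
  have dbl z : cos (z + z) - 1 = - 2 * sin z ^+ 2.
    by rewrite cosD -[X in _ - X = _](cos2Dsin2 z); ring.
  by rewrite chord !dbl sinB !sinD; ring.
by rewrite !mulr_gt0// exprn_gt0.
Qed.

Lemma regular_convex : convex_vertices (regular_vertices (N := N) c r theta).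
Proof.
move=> i k ki kSi; rewrite regularS !regularE.
have iN := ltn_ord i; have kN := ltn_ord k.
have kSi' : (k : nat) <> (i.+1 %% N)%N by move=> h; move/eqP: kSi; apply;
  apply/val_inj.
have ki' : (k : nat) <> i by move=> h; move/eqP: ki; apply; apply/val_inj.
have [ik|ik] := ltnP i k.
  have -> : (k : nat) = (i + (k - i))%N by lia.
  apply: Vcross; last by lia.
  have : (k : nat) <> i.+1 by move=> h; apply: kSi'; rewrite modn_small; lia.
  by lia.
rewrite -(VN k); have -> : (k + N)%N = (i + (k + N - i))%N by lia.
apply: Vcross; last by lia.
suff : (k + N <> i.+1)%N by lia.
by move=> h; apply: kSi'; rewrite -h modnDr modn_small.
Qed.

(** The turn moves each vertex to the next one, so it only renumbers the edges of the curve. *)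
Lemma regular_rot1 :
  (fun x => c + rot b (x - c)) @` polygon_region
    (regular_vertices (N := N) c r theta)
  = polygon_region (regular_vertices (N := N) c r theta).
Proof.
set v := regular_vertices _ _ _.
pose g := affine_map (cos b, sin b) (- sin b, cos b) (c - rot b c).
have gE : (fun x => c + rot b (x - c)) = g.
  apply/funext => x; rewrite [LHS]surjective_pairing /g /rot /affine_map/=.
  by congr pair; ring.
rewrite gE -polygon_region_affine; last first.
  by rewrite /cross/= mulrN opprK -!expr2 cos2Dsin2 oner_neq0.
rewrite -/g; have gv : g \o v = v \o (@ordS N).
  apply/funext => k; rewrite /= -gE /v regularS regularE.
  rewrite [LHS]surjective_pairing /V /rot /affine_map/=.
  have -> : theta + k.+1%:R * b = theta + k%:R * b + b by rewrite -natr1; ring.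
  rewrite (cosD (theta + k%:R * b) b) (sinD (theta + k%:R * b) b).
  by congr pair; ring.
rewrite gv /polygon_region.
have -> : polygonal_curve (v \o @ordS N) = polygonal_curve v.
  apply/seteqP; split=> x [i _ hx]; first by exists (ordS i).
  have [f fK Kf] := ordS_bij N.
  by exists (f i) => //; rewrite /edge/= Kf.
by [].
Qed.

Lemma regular_rot (k : nat) :
  (fun x => c + rot (k%:R * b) (x - c)) @` polygon_region
    (regular_vertices (N := N) c r theta)
  = polygon_region (regular_vertices (N := N) c r theta).
Proof.
elim: k => [|k ih].
  rewrite -[RHS]image_id; congr (_ @` _); apply/funext => x.
  rewrite [LHS]surjective_pairing /rot /affine_map/=
    mul0r cos0 sin0 [RHS]surjective_pairing.
  by congr pair; ring.
rewrite -[RHS]regular_rot1 -[in RHS]ih image_comp; congr (_ @` _);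
  apply/funext => x.
rewrite /= -natr1 mulrDl mul1r [LHS]surjective_pairing [RHS]surjective_pairing.
rewrite /rot /affine_map/= (cosD (k%:R * b) b) (sinD (k%:R * b) b).
by congr pair; ring.
Qed.

End regular.

(** * Diameter of the boundary *)

Lemma continuous_norm2_sub (R : realType) :
  continuous (fun z : (R * R) * (R * R) => norm2 (z.1 - z.2)).
Proof.
move=> z; apply: (@continuous_comp _ _ _
  (fun z : (R * R) * (R * R) => (z.1 - z.2).1 ^+ 2 + (z.1 - z.2).2 ^+ 2)
  (@Num.sqrt R)); last exact: sqrt_continuous.
have c1 : continuous (fun z : (R * R) * (R * R) => (z.1 - z.2).1).
  move=> w; apply: cvgB.
    by apply: (@continuous_comp _ _ _ fst fst); [exact: cvg_fst|exact: cvg_fst].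
  by apply: (@continuous_comp _ _ _ snd fst); [exact: cvg_snd|exact: cvg_fst].
have c2 : continuous (fun z : (R * R) * (R * R) => (z.1 - z.2).2).
  move=> w; apply: cvgB.
    by apply: (@continuous_comp _ _ _ fst snd); [exact: cvg_fst|exact: cvg_snd].
  by apply: (@continuous_comp _ _ _ snd snd); [exact: cvg_snd|exact: cvg_snd].
by apply: cvgD; [exact: (cvgM (c1 z) (c1 z))|exact: (cvgM (c2 z) (c2 z))].
Qed.

Lemma compact_closure_bounded (R : realType) (S : set (R * R)) :
  bounded_set S -> compact (closure S).
Proof.
move=> /bounded_set_box[M _ SM].
apply: (subclosed_compact (@closed_closure _ _) (compact_square (M := M))).
have /closure_id -> : closed (`[- M, M]%classic `*` `[- M, M]%classic :
  set (R * R)).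
  by apply: compact_closed; [exact: norm_hausdorff|exact: compact_square].
exact: closure_subset.
Qed.

(** Around an interior point there would be room to move horizontally in the direction of the sign
    of [s]. The values [1] and [-1] give the rightmost and leftmost points of the closure. *)
Lemma boundary_extremum (R : realType) (s : R) (Omega : set (R * R))
  (p : R * R) :
  s != 0 -> closure Omega p -> (forall x, closure Omega x -> s * x.1 <=
    s * p.1) ->
  boundary Omega p.
Proof.
move=> s0 cp pmax; split=> // ip.
have /nbhs_ballP[r /= r0 rO] : nbhs p Omega by exact: ip.
pose y : R * R := (p.1 + s * (r / (2 * `|s|)), p.2).
have sn : 0 < `|s| by rewrite normr_gt0.
have yO : Omega y.
  apply: rO; split; rewrite /ball/= /y/=; last by rewrite subrr normr0.
  rewrite opprD addrA subrr sub0r normrN normrM.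
  rewrite (ger0_norm (_ : 0 <= r / (2 * `|s|)));
    last by rewrite divr_ge0 ?mulr_ge0// ltW.
  have -> : `|s| * (r / (2 * `|s|)) = r / 2 by field; rewrite gt_eqF.
  by rewrite ltr_pdivrMr// ltr_pMr// ltr1n.
have := pmax _ (subset_closure yO); apply/negP;
  rewrite -ltNge /y/= mulrDr ltrDl.
by rewrite mulrA -expr2 mulr_gt0// ?exprn_even_gt0// divr_gt0// mulr_gt0.
Qed.

Lemma boundary_diameter (R : realType) (Omega : set (R * R)) :
  open Omega -> bounded_set Omega -> Omega !=set0 ->
  exists p q : R * R, [/\ boundary Omega p, boundary Omega q, 0 < norm2
    (p - q) &
    forall x y, boundary Omega x -> boundary Omega y -> norm2 (x - y) <=
      norm2 (p - q)].
Proof.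
move=> oO bO [x0 Ox0].
have cO := compact_closure_bounded bO.
have cO0 : closure Omega !=set0 by exists x0; exact: subset_closure.
have cfst (s : R) : {within closure Omega, continuous
  (fun x : R * R => s * x.1)}.
  by apply: continuous_subspaceT => x; apply: cvgMr; exact: cvg_fst.
have [p1 p1O p1max] := compact_EVT_max cO0 cO (cfst 1).
have [p2 p2O p2max] := compact_EVT_max cO0 cO (cfst (-1)).
have b1 : boundary Omega p1.
  apply: (@boundary_extremum _ 1) => //; first by move: p1O; rewrite inE.
  by move=> x xO; apply: p1max; rewrite inE.
have b2 : boundary Omega p2.
  apply: (@boundary_extremum _ (-1)) => //.
    by move: p2O; rewrite inE.
  by move=> x xO; apply: p2max; rewrite inE.
(* Otherwise the closure lies on a vertical line, and the interior point [x0] is extremal as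
   well. *)
have p12 : p1 != p2.
  apply/eqP => e.
  have : ~ boundary Omega x0 by move=> [_]; apply; move: oO; rewrite openE;
    exact.
  apply; apply: (@boundary_extremum _ 1) => //; first exact: subset_closure.
  move=> x xO; have := p1max x; rewrite inE => /(_ xO).
  have := p2max x0; rewrite inE => /(_ (subset_closure Ox0)).
  by rewrite -e; lra.
have cB : compact (boundary Omega).
  apply: (subclosed_compact _ cO); last by move=> x [].
  apply: closedI; first exact: closed_closure.
  by apply: open_closedC; exact: open_interior.
have cBB := compact_setX cB cB.
have BB0 : boundary Omega `*` boundary Omega !=set0 by exists (p1, p2).
have [z zB zmax] := compact_EVT_max BB0 cBB
  (continuous_subspaceT (@continuous_norm2_sub R)).
move: zB; rewrite inE => -[zB1 zB2].
have zm x y : boundary Omega x -> boundary Omega y -> norm2 (x - y) <=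
  norm2 (z.1 - z.2).
  by move=> bx by_; apply: (zmax (x, y)); rewrite inE.
exists z.1, z.2; split=> //.
apply: lt_le_trans (zm _ _ b1 b2).
rewrite lt_def norm2_ge0 andbT; apply: contra_neq p12 =>
  /(congr1 (fun t => t ^+ 2)).
rewrite sqr_norm2 expr0n/= => /eqP; rewrite paddr_eq0 ?sqr_ge0// !sqrf_eq0
  !subr_eq0.
by move=> /andP[/eqP e1 /eqP e2]; case: (p1) (p2) e1 e2 => [? ?] [? ?] /= -> ->.
Qed.

Lemma hausdorff_dist_stretch_ge (R : realType) (S : set (R * R)) (p q : R * R)
    (f rho : R * R -> R * R) (a : R) :
  S p -> S q -> (forall x y, S x -> S y -> norm2 (x - y) <= norm2 (p - q)) ->
  a * norm2 (p - q) <= norm2 (f p - f q) -> rigid_motion rho ->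
  (((a - 1) * norm2 (p - q) / 2)%:E <= hausdorff_dist (f @` S) (rho @` S))%E.
Proof.
move=> Sp Sq Smax fpq rm; rewrite leNgt; apply/negP => hlt.
have near x : S x -> exists2 z, S z & norm2 (f x - rho z) < (a - 1) * norm2
  (p - q) / 2.
  move=> Sx.
  have : (dist_to (rho @` S) (f x) < ((a - 1) * norm2 (p - q) / 2)%:E)%E.
    apply: le_lt_trans hlt; rewrite /hausdorff_dist le_max; apply/orP; left.
    by apply: ereal_sup_ubound; exists (f x) => //; exists x.
  by move=> /ereal_inf_lt[_ [_ [z Sz <-] <-]]; rewrite lte_fin => h; exists z.
have [z Sz pz] := near _ Sp; have [w Sw qw] := near _ Sq.
have e : f p - f q = (f p - rho z) + ((rho z - rho w) + - (f q - rho w)).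
  by rewrite opprB addrA subrKA addrA subrK.
have h1 := norm2_triangle (f p - rho z) ((rho z - rho w) + - (f q - rho w)).
have h2 := norm2_triangle (rho z - rho w) (- (f q - rho w)).
have h3 : norm2 (rho z - rho w) <= norm2 (p - q).
  by rewrite [leLHS](rm z w); exact: Smax.
move: fpq; rewrite e; rewrite norm2N in h2; lra.
Qed.

(** * The stretched regular polygons *)

Lemma cheeger_ge0 (R : realType) (Omega : set (R * R)) : (0 <= cheeger Omega)%E.
Proof.
apply: le_ereal_inf_tmp => _ [E [_ _ aE] <-].
by rewrite mule_ge0// ?perimeter_ge0// inve_ge0 ltW.
Qed.

Lemma norm2_scale (R : realType) (e : R * R) (y : R) : sqn e = 1 -> 0 <= y ->
  norm2 (y * e.1, y * e.2) = y.
Proof.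
move=> e1 y0; rewrite /norm2/= -[RHS](ger0_norm y0) -sqrtr_sqr.
by congr Num.sqrt; rewrite -[RHS]mulr1 -e1 /sqn; ring.
Qed.

Lemma bounded_norm2 (R : realType) (S : set (R * R)) (c : R * R) :
  bounded_set S ->
  exists2 r : R, 0 < r & forall x, S x -> norm2 (x - c) <= r.
Proof.
move=> /bounded_set_box[M M0 SM]; exists (2 * M + norm2 c).
  by rewrite ltr_pwDl ?norm2_ge0// mulr_gt0.
move=> x /SM[] /=; rewrite !in_itv/= -!ler_norml => h1 h2.
apply: le_trans (norm2_triangle _ _) _; rewrite norm2N lerD2r.
have M20 : 0 <= 2 * M by rewrite mulr_ge0// ltW.
rewrite norm2_le//.
have k (y : R) : `|y| <= M -> y ^+ 2 <= M ^+ 2.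
  by move=> h; rewrite -real_normK ?num_real// ler_pXn2r ?nnegrE// ltW.
have := k _ h1; have := k _ h2; have := sqr_ge0 M; nra.
Qed.

(* At [a = 1 + eps] the deficit [h a - h0] is of order [eps ^ 2], while the
   distance [x a] is of order [eps]; when [C < 0] the contradiction comes from
   an [a0] with a nonnegative deficit. *)
Lemma no_power_bound (R : realType) (p C K k h0 a0 : R) (h x : R -> R) :
  0 < p -> p < 2 -> 0 < k -> 0 <= K -> 2 <= a0 -> h0 <= h a0 -> 0 < x a0 ->
  (forall a, 1 < a -> a <= 2 -> k * (a - 1) <= x a) ->
  (forall a, 1 < a -> a <= 2 -> h a - h0 <= K * (a - 1) ^+ 2) ->
  (forall a, 1 < a -> a <= a0 -> x a `^ p <= C * (h a - h0)) -> False.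
Proof.
move=> p0 p2 k0 K0 a02 ha0 xa0 xk hK H.
have [C0|C0] := ltP C 0.
  have := H a0 (lt_le_trans (ltr1n _ 2 : 1 < 2) a02) (lexx _).
  apply/negP; rewrite -ltNge; apply: (@le_lt_trans _ _ 0).
    by rewrite mulr_le0_ge0 ?(ltW C0)// subr_ge0.
  by rewrite powR_gt0.
have kp : 0 < k `^ p by exact: powR_gt0.
have CK : 0 <= C * K by rewrite mulr_ge0.
(* The aim is [C K eps^(2 - p) < k^p]. The added 1 keeps the quotient defined when [C * K = 0] and
   makes the final comparison strict. *)
pose s := k `^ p / (C * K + 1).
have s0 : 0 < s by rewrite divr_gt0// ltr_wpDl.
have p2' : 0 < 2 - p by rewrite subr_gt0.
pose eps := Num.min 1 (s `^ (2 - p)^-1).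
have e0 : 0 < eps by rewrite lt_min ltr01 powR_gt0.
have e1 : eps <= 1 by rewrite ge_min lexx.
have es : eps `^ (2 - p) <= s.
  have -> : s = (s `^ (2 - p)^-1) `^ (2 - p).
    by rewrite -powRrM mulVf ?gt_eqF// powRr1// ltW.
  apply: ge0_ler_powR; rewrite ?nnegrE ?(ltW e0) ?(ltW p2') ?powR_ge0//.
  by rewrite ge_min lexx orbT.
have a1 : 1 < 1 + eps by rewrite ltrDl.
have a2 : 1 + eps <= 2 by rewrite -[2]/(1 + 1) lerD2l.
have := H _ a1 (le_trans a2 a02); apply/negP; rewrite -ltNge.
have ea : 1 + eps - 1 = eps by rewrite addrC addKr.
apply: (@le_lt_trans _ _ (C * (K * eps ^+ 2))).
  by apply: ler_wpM2l => //; rewrite -[in X in _ <= X]ea; exact: hK.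
apply: (@lt_le_trans _ _ ((k * eps) `^ p)); last first.
  apply: ge0_ler_powR; rewrite ?nnegrE ?(ltW p0) ?mulr_ge0 ?(ltW k0)
    ?(ltW e0)//.
    by apply: le_trans (xk _ a1 a2); rewrite ea mulr_ge0 ?(ltW k0) ?(ltW e0).
  by rewrite -[in X in X <= _]ea; exact: xk.
have -> : eps ^+ 2 = eps `^ p * eps `^ (2 - p).
  rewrite -powRD; last by rewrite (gt_eqF e0) implybT.
  by rewrite addrC subrK -powR_mulrn// ltW.
rewrite powRM ?(ltW k0) ?(ltW e0)// mulrA.
apply: (@le_lt_trans _ _ (C * K * (eps `^ p * s))).
  by apply: ler_wpM2l => //; apply: ler_wpM2l => //; exact: powR_ge0.
have -> : C * K * (eps `^ p * s) = k `^ p * eps `^ p * (C * K / (C * K + 1)).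
  by rewrite /s; ring.
rewrite -[X in _ < X]mulr1 ltr_pM2l ?mulr_gt0 ?powR_gt0//.
by rewrite ltr_pdivrMr ?mul1r ?ltrDl// ltr_wpDl.
Qed.

Lemma le_poweR_bound (R : realType) (X : \bar R) (x p C h h0 : R) : 0 <= p ->
  0 <= x ->
  (x%:E <= X)%E -> (poweR X p <= C%:E * (h%:E - h0%:E))%E -> x `^ p <=
    C * (h - h0).
Proof.
move=> p0 x0 xX; rewrite -EFinB -EFinM => H.
rewrite -lee_fin -poweR_EFin; apply: le_trans H.
apply: gt0_ler_poweR => //; rewrite in_itv/= ?leey ?andbT ?lee_fin//.
by apply: le_trans xX; rewrite lee_fin.
Qed.

(** Packages one family with real-valued Cheeger constants and distance bounds independent of the
    rigid motion, so that both parts reduce to the same comparison of powers of [a - 1]. *)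
Lemma stretched_regular_ngons (R : realType) (N : nat) (hN : (3 <= N)%N)
    (Omega0 : set (R * R)) :
  is_regular_ngon N Omega0 -> area Omega0 = 1%E ->
  exists (Om : R -> set (R * R)) (h x : R -> R) (h0 r0 k D : R),
  [/\ cheeger Omega0 = h0%:E, 0 <= h0, 0 < r0, 0 < k & 0 < D] /\
  (forall a, 1 < a -> a <= 2 -> k * (a - 1) <= x a) /\
  (forall a, 1 < a -> 0 < x a) /\
  forall a, 1 < a ->
  [/\ is_ngon N (Om a), area (Om a) = 1%E, cheeger (Om a) = (h a)%:E,
    h a - h0 <= h0 * (a - 1) ^+ 2 & a / (8 * r0) <= h a] /\
  [/\ (diam (Om a) <= (2 * a * r0)%:E)%E,
    forall rho, rigid_motion rho -> ((x a)%:E <=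
      area (Om a `+` rho @` Omega0))%E &
    forall rho, rigid_motion rho -> ((D * (a - 1))%:E <=
      hausdorff_dist (boundary (Om a)) (boundary (rho @` Omega0)))%E].
Proof.
move=> [c [r [theta [r_gt0 OE]]]] aO.
have oO : open Omega0 by rewrite OE; exact: open_polygon_region.
have bO : bounded_set Omega0 by rewrite OE; exact: bounded_polygon_region.
have nO : Omega0 !=set0.
  apply/set0P/eqP => O0; move: aO; rewrite O0 /area measure0 => /eqP.
  by rewrite eq_sym onee_eq0.
have mO : measurable (Omega0 : set (plane R)) by exact: open_measurable2.
have aOy : (area Omega0 < +oo)%E by rewrite aO ltry.
have [M _ OM] := bounded_set_box bO.
have cM := @compact_square R M.
have [r0 r00 Or] := bounded_norm2 c bO.
have sym k : (fun y => c + rot (k%:R * (2 * pi / N%:R)) (y - c)) @` Omega0 =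
  Omega0.
  by rewrite OE; exact: regular_rot.
have [p [q [bp bq D0 Dmax]]] := boundary_diameter oO bO nO.
set D := norm2 (p - q) in D0 Dmax.
(* The Hausdorff estimate dictates this direction; the area estimate works for every unit vector. *)
pose e : R * R := ((p - q).1 / D, (p - q).2 / D).
have e1 : sqn e = 1.
  rewrite /sqn /e /= !expr_div_n -mulrDl.
  have -> : (p.1 - q.1) ^+ 2 + (p.2 - q.2) ^+ 2 = D ^+ 2 by rewrite sqr_norm2.
  by rewrite divff// expf_neq0// gt_eqF.
pose m := half_inertia c Omega0.
have m0 : 0 < m := half_inertia_gt0 c cM OM mO aO.
have h0fin : cheeger Omega0 \is a fin_num.
  by rewrite ge0_fin_numE ?cheeger_ge0//; exact: cheeger_lty.
pose h0 := fine (cheeger Omega0).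
have h0E : cheeger Omega0 = h0%:E by rewrite fineK.
have h00 : 0 <= h0 by rewrite fine_ge0// cheeger_ge0.
(* The moment comparison with [r1 = a * r0]; the minimum with 1 accounts for disjoint sets. For
   [1 < a <= 2] the slope [k] follows from [a^2 - 1 >= 2 (a - 1)] and [2 a + 1 <= 5]. *)
pose x a := Num.min 1 ((a ^+ 2 - 1) * m / ((2 * a + 1) * r0) ^+ 2).
pose k := Num.min 1 (2 * m / (5 * r0) ^+ 2).
exists (fun a => stretch e a @` Omega0),
  (fun a => fine (cheeger (stretch e a @` Omega0))).
exists x, h0, r0, k, (D / 2).
have k0 : 0 < k by rewrite lt_min ltr01 divr_gt0 ?mulr_gt0 ?exprn_gt0 ?mulr_gt0.
split; first by split=> //; rewrite divr_gt0.
split.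
  move=> a a1 a2; rewrite /x le_min.
  have am0 : 0 < a - 1 by rewrite subr_gt0.
  apply/andP; split.
    apply: (@le_trans _ _ (1 * (a - 1))).
      by apply: ler_wpM2r; [exact: ltW|rewrite ge_min lexx].
    by rewrite mul1r; lra.
  apply: (@le_trans _ _ (2 * m / (5 * r0) ^+ 2 * (a - 1))).
    by apply: ler_wpM2r; [exact: ltW|rewrite ge_min lexx orbT].
  rewrite mulrAC; apply: ler_pM.
  - by rewrite !mulr_ge0// ltW.
  - by rewrite invr_ge0 sqr_ge0.
  - rewrite -subr_ge0; have -> : (a ^+ 2 - 1) * m - 2 * m * (a - 1) =
      m * (a - 1) ^+ 2 by ring.
    by rewrite mulr_ge0 ?sqr_ge0 ?ltW.
  - rewrite lef_pV2 ?posrE ?exprn_gt0 ?mulr_gt0//; last by lra.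
    by rewrite ler_pXn2r ?nnegrE ?mulr_ge0 ?(ltW r00)// ?ler_pM2r//; lra.
split.
  move=> a a1; have a21 : 0 < 2 * a + 1 by lra.
  have aa1 : 0 < a ^+ 2 - 1 by rewrite subr_gt0 exprn_egt1.
  by rewrite lt_min ltr01 divr_gt0 ?exprn_gt0 ?mulr_gt0.
move=> a a1; have a0 : 0 < a by exact: lt_trans a1.
have cr := stretch_cross e1 a0.
have [i1 i2] := stretch_inv e1 a0.
set Om := stretch e a @` Omega0.
have mOm : measurable (Om : set (plane R)).
  by apply: image_affine_measurable => //; rewrite cr normr1.
have aOm : area Om = 1%E by rewrite /Om area_affine// cr normr1.
have bOm : bounded_set Om by exact: bounded_affine.
have [M' _ OmM] := bounded_set_box bOm.
have r1 y : Omega0 y -> norm2 (stretch e a y - stretch e a c) <= a * r0.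
  move=> Oy; rewrite stretchB; apply: le_trans
    (stretch_norm_le e1 a0 _ (ltW a1)) _.
  by rewrite ler_pM2l//; exact: Or.
have cr1 : `|cross (stretch_col e a).1 (stretch_col e a).2| =
  1 by rewrite cr normr1.
have hle : (cheeger Om <= (((1 + (a ^+ 2 + a^-1 ^+ 2) / 2) / 2) * h0)%:E)%E.
  rewrite EFinM -h0E -(stretch_sqn_inv e1 a0).
  apply: (cheeger_stretch_le hN cr1 i1 i2 _ cM OM mO aOy) => j y Oy.
  by rewrite -[X in X _](sym j); exists y.
have hfin : cheeger Om \is a fin_num.
  by rewrite ge0_fin_numE ?cheeger_ge0//; apply: le_lt_trans hle _;
    rewrite ltry.
split; split.
- by rewrite /Om OE; apply: convex_is_ngon_affine;
    [exact: hN|rewrite cr|exact: regular_convex].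
- exact: aOm.
- by rewrite fineK.
- move: hle; rewrite -[X in (X <= _)%E](fineK hfin) lee_fin => hle.
  (* The factor is [((a + 1/a) / 2)^2], which exceeds 1 by [((a - 1/a) / 2)^2]. *)
  have : ((1 + (a ^+ 2 + a^-1 ^+ 2) / 2) / 2 - 1) <= (a - 1) ^+ 2.
    have -> : (1 + (a ^+ 2 + a^-1 ^+ 2) / 2) / 2 - 1 =
      (a - 1) ^+ 2 * ((1 + a^-1) / 2) ^+ 2.
      by field; rewrite gt_eqF.
    rewrite ler_piMr ?sqr_ge0// exprn_ile1// ?divr_ge0 ?addr_ge0 ?invr_ge0
      ?(ltW a0)//.
    have : a^-1 <= 1 by rewrite invf_le1// ltW.
    by lra.
  by move=> /(ler_wpM2l h00); lra.
- by rewrite -lee_fin fineK//; exact: (cheeger_stretch_ge e1 a0 r00 Or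
    (@compact_square R M') OmM mO aOy).
- apply: ge_ereal_sup => _ [_ [y Oy <-] [_ [z Oz <-] <-]];
    rewrite lee_fin /dist2.
  have -> : stretch e a y - stretch e a z = (stretch e a y - stretch e a c)
     + - (stretch e a z - stretch e a c) by rewrite opprB addrA subrK.
  apply: le_trans (norm2_triangle _ _) _;
    rewrite norm2N -mulrA -[2]/(1 + 1) mulrDl mul1r.
  by apply: lerD; exact: r1.
- move=> rho /rigid_motion_affine[p' [q' [t' [-> sp sq pq]]]].
  have dpq := orthonormal_cross sp sq pq.
  have mB : measurable (affine_map p' q' t' @` Omega0 : set (plane R)).
    exact: image_affine_measurable.
  have := area_symdiff_ge hN sym cM OM mO aO t' cr1 sp sq pq e1 Or r1.
  rewrite (stretch_dot e1 a0) -/Om -/m => H.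
  apply: (@le_trans _ _ (area (Om `\` affine_map p' q' t' @` Omega0)));
    last first.
    apply: (le_measure (lebesgue2 R)); rewrite ?inE.
    - exact: measurableD.
    - by apply: measurableU; exact: measurableD.
    - by move=> y; left.
  case: H => H; first by apply: le_trans H; rewrite lee_fin ge_min lexx.
  apply: (@le_trans _ _ ((a ^+ 2 - 1) * m / ((2 * a + 1) * r0) ^+ 2)%:E).
    by rewrite lee_fin ge_min lexx orbT.
  rewrite mulrC EFinM lee_pdivrMl ?exprn_gt0 ?mulr_gt0//; last by lra.
  by have -> : (2 * a + 1) * r0 = 2 * (a * r0) + r0 by ring.
- move=> rho rm; have [p' [q' [t' [rhoE sp sq pq]]]] := rigid_motion_affine rm.
  have d1 := orthonormal_cross sp sq pq.
  have d0 : cross p' q' != 0 by rewrite -normr_gt0 d1.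
  have dT : cross (stretch_col e a).1 (stretch_col e a).2 !=
    0 by rewrite cr oner_neq0.
  rewrite {1}rhoE (boundary_affine _ _ d0) (boundary_affine _ _ dT) -rhoE.
  have -> : D / 2 * (a - 1) = (a - 1) * norm2 (p - q) / 2 by rewrite -/D; ring.
  apply: hausdorff_dist_stretch_ge => //.
  rewrite -/(stretch e a) stretchB.
  have -> : p - q = (D * e.1, D * e.2).
    by rewrite [LHS]surjective_pairing /e/=; congr pair; field; rewrite gt_eqF.
  by rewrite (stretch_along e1 a0) !(norm2_scale e1) ?mulr_ge0 ?(ltW a0)
    ?(ltW D0).
Qed.

Theorem mainTheorem3 (R : realType) (N : nat) (hN : (3 <= N)%N)
    (Omega0 : set (R * R)) (hreg : is_regular_ngon N Omega0)
    (harea : area Omega0 = 1%E) (p : R) (hp0 : 0 < p) (hp2 : p < 2) :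
  (~ exists C1 : R, forall Omega : set (R * R),
       is_ngon N Omega -> area Omega = 1%E ->
       exists rho : R * R -> R * R, rigid_motion rho /\
         (poweR (area (Omega `+` rho @` Omega0)) p
            <= C1%:E * (cheeger Omega - cheeger Omega0))%E)
  /\
  (~ forall M : R, 0 < M -> exists C2 : R, forall Omega : set (R * R),
       is_ngon N Omega -> (diam Omega < M%:E)%E -> area Omega = 1%E ->
       exists rho : R * R -> R * R, rigid_motion rho /\
         (poweR (hausdorff_dist (boundary Omega) (boundary (rho @` Omega0))) p
            <= C2%:E * (cheeger Omega - cheeger Omega0))%E).
Proof.
have [Om [h [x [h0 [r0 [k [D [[h0E h00 r00 k0 D0] [xk [x0 HOm]]]]]]]]]] :=
  stretched_regular_ngons hN hreg harea.
(* At this stretch the lower bound [a / (8 * r0)] exceeds [h0], so the deficit is nonnegative there;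
   the summand 2 keeps the interval [1 < a <= 2] below [a0]. *)
pose a0 := 8 * r0 * h0 + 2.
have a02 : 2 <= a0 by rewrite lerDr !mulr_ge0// ltW.
have a01 : 1 < a0 by apply: lt_le_trans a02; rewrite ltr1n.
have ha0 : h0 <= h a0.
  have [[_ _ _ _ h1] _] := HOm _ a01; apply: le_trans h1.
  by rewrite ler_pdivlMr ?mulr_gt0// /a0 mulrC lerDl.
have hK a : 1 < a -> a <= 2 -> h a - h0 <= h0 * (a - 1) ^+ 2.
  by move=> a1 _; have [[_ _ _ + _] _] := HOm _ a1.
split.
  move=> [C H]; apply: (no_power_bound hp0 hp2 k0 h00 a02 ha0 (x0 _ a01) xk hK) => a a1 _.
  have [[nO aO hO _ _] [_ xO _]] := HOm _ a1.
  have [rho [rm]] := H _ nO aO; rewrite hO h0E.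
  exact: (le_poweR_bound (ltW hp0) (ltW (x0 _ a1)) (xO _ rm)).
(* One diameter bound for all [a <= a0], including the large stretch that refutes negative
   constants; the added 1 makes it strict. *)
move=> H; have [|C {}H] := H (2 * a0 * r0 + 1).
  by rewrite ltr_wpDl// !mulr_ge0 ?(ltW r00)// ltW// (lt_trans _ a01).
have y0 a : 1 < a -> 0 < D * (a - 1) by move=> a1; rewrite mulr_gt0// subr_gt0.
apply: (no_power_bound (x := fun a => D * (a - 1)) hp0 hp2 D0 h00 a02 ha0
  (y0 _ a01) (fun _ _ _ => lexx _) hK) => a a1 aa0.
have [[nO aO hO _ _] [dO _ yO]] := HOm _ a1.
have [|rho [rm]] := H _ nO _ aO.
  apply: le_lt_trans dO _; rewrite lte_fin.
  have : 2 * a * r0 <= 2 * a0 * r0 by rewrite ler_pM2r// ler_pM2l.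
  by lra.
rewrite hO h0E.
exact: (le_poweR_bound (ltW hp0) (ltW (y0 _ a1)) (yO _ rm)).
Qed.
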